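(* Let $m\geq 2$ be an integer. For any $c\in[0,1]$, there exists a set $\mathscr{A}_{m,c}\subseteq \mathbb{R}^m$ of packing dimension $m-1$ consisting of vectors $\underline{\xi}\in\mathbb{R}^m$ that satisfy $$\Theta(\underline{\xi})=c$$ and, for every $N$, $$\liminf_{Q\to\infty} Q^{N}\psi_{\underline{\xi}}(Q)=0.$$ In particular $\mathbb{D}_m=[0,1]$.
   Context: For $x\in\mathbb{R}$ let $\Vert x\Vert$ be the distance of $x$ to the nearest integer, and for $\underline{x}=(x_1,\ldots,x_m)\in\mathbb{R}^m$ let $\Vert\underline{x}\Vert=\max\{\Vert x_1\Vert,\ldots,\Vert x_m\Vert\}$. For $\underline{\xi}\in\mathbb{R}^m$ and real $Q\geq 1$ let $\psi_{\underline{\xi}}(Q)=\min_{1\leq q\leq Q}\Vert q\underline{\xi}\Vert$, where $q$ ranges over the positive integers up to $Q$. The Dirichlet constant of $\underline{\xi}$ is $\Theta(\underline{\xi})=\limsup_{Q\to\infty}Q^{1/m}\psi_{\underline{\xi}}(Q)$, and the Dirichlet spectrum is $\mathbb{D}_m=\{\Theta(\underline{\xi}):\underline{\xi}\in\mathbb{R}^m\}$. *)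

(* Defs.v *)
From HB Require Import structures.
From mathcomp Require Import all_boot all_order all_algebra.
From mathcomp Require Import all_classical all_reals all_analysis.

Set Implicit Arguments.
Unset Strict Implicit.
Unset Printing Implicit Defensive.

Import Order.TTheory GRing.Theory Num.Theory.
Import numFieldNormedType.Exports.

Local Open Scope classical_set_scope.
Local Open Scope ring_scope.

Section Dirichlet.
Context {R : realType}.

Definition dist_int (x : R) : R := inf [set `|x - n%:~R| | n in [set: int]].

Definition dist_intv {m : nat} (x : 'rV[R]_m) : R :=
  \big[Num.max/0]_(i < m) dist_int (x ord0 i).

(* For Q >= 1 the infimum runs over a finite nonempty set, so it is a minimum;
   the value at Q < 1 plays no role in the limits at infinity below. *)
Definition psi {m : nat} (xi : 'rV[R]_m) (Q : R) : R :=
  inf [set dist_intv (q%:R *: xi) | q in [set q : nat | (1 <= q)%N /\ q%:R <= Q]].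

Definition dirichlet_constant {m : nat} (xi : 'rV[R]_m) : \bar R :=
  limf_esup (fun Q : R => (Q `^ (m%:R^-1) * psi xi Q)%:E) (pinfty_nbhs R).

Definition dirichlet_spectrum (m : nat) : set (\bar R) :=
  [set dirichlet_constant xi | xi in [set: 'rV[R]_m]].

End Dirichlet.

Section PackingDimension.
Context {R : realType} {V : pseudoMetricType R}.
Local Open Scope ereal_scope.

(* The packing measure of Tricot.  A packing is a family of pairwise disjoint
   closed balls, each recorded as the pair (centre, radius).  On 'rV[R]_m the
   balls are those of the max norm; replacing it by an equivalent norm, such as
   the Euclidean one, does not change the packing dimension. *)
Definition is_packing (A : set V) (delta : R) (P : set (V * R)) : Prop :=
  (forall p, P p -> [/\ A p.1, (0 < p.2)%R & (p.2 <= delta)%R]) /\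
  trivIset P (fun p => closed_ball p.1 p.2).

Definition packing_size (s : R) (P : set (V * R)) : \bar R :=
  \esum_(p in P) (((2 * p.2) `^ s)%R)%:E.

(* Nondecreasing in delta, so that the limit as delta tends to 0 is the infimum
   over delta > 0 taken in packing_premeasure. *)
Definition packing_premeasure_delta (s delta : R) (A : set V) : \bar R :=
  ereal_sup [set packing_size s P | P in is_packing A delta].

Definition packing_premeasure (s : R) (A : set V) : \bar R :=
  ereal_inf [set packing_premeasure_delta s delta A |
    delta in [set delta : R | (0 < delta)%R]].

Definition packing_measure (s : R) (A : set V) : \bar R :=
  ereal_inf [set \sum_(0 <= i <oo) packing_premeasure s (F i) |
    F in [set F : nat -> set V | A `<=` \bigcup_i F i]].

Definition packing_dimension (A : set V) : \bar R :=
  ereal_inf [set s%:E |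
    s in [set s : R | (0 <= s)%R /\ packing_measure s A = 0]].

End PackingDimension.

(* Main.v *)
Require Import Defs.
From mathcomp Require Import all_boot all_order all_algebra.
From mathcomp Require Import all_classical all_reals all_analysis.
From mathcomp Require Import ring lra zify.
Import Order.TTheory GRing.Theory Num.Theory.
Import numFieldNormedType.Exports.
Local Open Scope classical_set_scope.
Local Open Scope ring_scope.

(** Write m = p + 1 with p >= 1, and number coordinates from 0 to p.

    The peak.  Let y be a rational point whose coordinates n_i / a_i, in lowest
    terms, have pairwise coprime denominators, and let q be their product.  The
    group Z^m + Z y is then the product of the groups (1/a_i) Z.  For a
    primitive vector l of this lattice and Q in a suitable class modulo q, the
    point z = y + l / Q has denominator Q, and the differences between n z and
    the points of Z^m have the form v + (n / Q) l with v in the lattice.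
    The vector l can be chosen long, almost parallel to the
    first axis, and such that the lattice modulo l is nearly cubic, of minimum
    1/X.  Hence nothing below Q improves on q by more than a factor close to 1,
    and psi_z is nearly constant, about X^p / Q, on [q, Q).  The product
    T^(1/m) psi_z(T) therefore peaks just below T = Q at about
    (X^m / Q)^(p/m), and any value in (0, 1] is obtained by choosing
    Q >= X^m ([sharp_step], [sharp_point]).

    The valleys.  Near a rational point w of denominator q, psi is tiny on any
    prescribed range starting at q.  The hyperplane of points sharing the first
    coordinate of w is rational, and on it Dirichlet's theorem has the exponent
    1/p > 1/m, so that T^(1/m) psi(T) tends to 0, uniformly
    ([hyperplane_dirichlet]).  So one may move from w to any point y of a fine
    grid in this hyperplane without creating a peak, and only then create the
    peak c at a point z very close to y ([grid], [stage]).  Going on from z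
    produces points xi with Theta(xi) = c; since xi is closer to the w of level
    k than q^(-k), also liminf Q^N psi(Q) = 0 for every N.

    The dimension.  All choices of grid points form a tree.  Siblings differ at
    least as much in some later coordinate as in the first one, so the limit set
    is a Lipschitz graph over a subset of R^p and a volume count gives packing
    dimension at most p ([packing_volume], [packing_measure_limit0]).  On the
    other hand the grids fill a p-dimensional cube, at scales as small as
    wanted compared with all earlier data: for s < p, a set that is dense
    in some part of the limit set has infinite s-dimensional packing premeasure,
    and Baire's argument excludes a countable cover by sets of finite
    premeasure ([dense_premeasure], [packing_measure_limit_neq0]).

    The spectrum is then [0, 1] because these limit sets are nonempty and
    because of Dirichlet's theorem ([dirichlet_constant_bounds]). *)

(** * Rational points where psi has a prescribed peak *)

(** For i = 0, ..., p these are the coordinates of an integer vector with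
    successive ratios s_1, ..., s_p and last coordinate 1. *)
Definition tail_prod (s : nat -> nat) (p i : nat) : nat :=
  (\prod_(i.+1 <= j < p.+1) s j)%N.

Lemma tail_prod_last s p : tail_prod s p p = 1%N.
Proof. by rewrite /tail_prod big_geq. Qed.

Lemma tail_prodS s p i : (i < p)%N ->
  tail_prod s p i = (s i.+1 * tail_prod s p i.+1)%N.
Proof. by move=> ip; rewrite /tail_prod big_ltn. Qed.

Lemma prod_nat_gt0 (s : nat -> nat) m p : (forall j, j < p -> 0 < s j)%N ->
  (0 < \prod_(m <= j < p) s j)%N.
Proof.
by move=> s0; rewrite big_nat_cond prodn_cond_gt0// => j /andP[/andP[_ /s0]].
Qed.

Lemma tail_prod_gt0 s p i : (forall j, j <= p -> 0 < s j)%N ->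
  (0 < tail_prod s p i)%N.
Proof. by move=> s0; rewrite /tail_prod; apply: prod_nat_gt0. Qed.

Lemma tail_prod_le_first s p i : (forall j, j <= p -> 0 < s j)%N -> (0 < i <= p)%N ->
  (s i * tail_prod s p i <= tail_prod s p 0)%N.
Proof.
move=> s0 /andP[i0 ip].
rewrite /tail_prod (@big_cat_nat _ _ _ i 1 p.+1)//=; last exact: leqW.
rewrite [X in (_ <= _ * X)%N]big_ltn// leq_pmull// prod_nat_gt0// => j ji.
by rewrite s0// (leq_trans (ltnW ji)).
Qed.

Lemma dvdn_tail_prod s p i j : (i < j <= p)%N -> (s j %| tail_prod s p i)%N.
Proof.
move=> /andP[ij jp].
rewrite /tail_prod (@big_cat_nat _ _ _ j i.+1 p.+1)//=; last exact: leqW.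
by rewrite [X in (_ %| _ * X)%N]big_ltn// dvdn_mull// dvdn_mulr.
Qed.

(** An integer vector g that is close to the line of h lies on it.  The
    deviation g_i - g_0 h_i / h_0 is a multiple of 1 / s_i as soon as the
    deviation of index i - 1 vanishes, so the bounds make all deviations vanish
    in turn; as h_p = 1, the vector h is primitive. *)
Lemma almost_parallel (p : nat) (s : nat -> nat) (g : nat -> int) :
  (forall i, i <= p -> 0 < s i)%N ->
  let h := tail_prod s p in
  (forall i, (0 < i <= p)%N ->
    `|g i * (h 0%N)%:Z - g 0%N * (h i)%:Z| * (s i)%:Z < (h 0%N)%:Z) ->
  forall i, (i <= p)%N -> g i = g p * (h i)%:Z.
Proof.
move=> s0 h H.
have h0 i : (h i)%:Z != 0.
  by rewrite eqz_nat; apply: lt0n_neq0; apply: tail_prod_gt0.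
have key i : (i <= p)%N -> g i * (h 0%N)%:Z = g 0%N * (h i)%:Z.
  elim: i => [//|i IH ip].
  have {IH} := IH (ltnW ip).
  have hS : (h i)%:Z = (s i.+1)%:Z * (h i.+1)%:Z.
    by rewrite -PoszM -tail_prodS.
  rewrite hS => IH.
  have := H i.+1 ip.
  have -> : `|g i.+1 * (h 0%N)%:Z - g 0%N * (h i.+1)%:Z| * (s i.+1)%:Z =
     `|(s i.+1)%:Z * g i.+1 - g i| * (h 0%N)%:Z.
    rewrite -[X in _ * X]ger0_norm// -[X in _ = _ * X]ger0_norm// -!normrM.
    by rewrite [in RHS]mulrBl IH; congr `|_|; ring.
  rewrite gtr_pMl ?ltz_nat ?tail_prod_gt0// => lt1.
  have /eqP : (s i.+1)%:Z * g i.+1 - g i = 0 by lia.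
  rewrite subr_eq0 => /eqP e.
  have sn : (s i.+1)%:Z != 0 by rewrite eqz_nat; apply/lt0n_neq0/s0.
  by apply: (mulfI sn); rewrite mulrA e IH; ring.
move=> i ip; apply: (mulIf (h0 0%N)); rewrite key//.
have := key p (leqnn p); rewrite {2}/h tail_prod_last mulr1 => <-.
by rewrite mulrAC.
Qed.

Lemma coprime_prod_nat (p : nat) (a : nat -> nat) (b : nat) :
  (forall i, (i < p)%N -> coprime (a i) b) ->
  coprime (\prod_(0 <= i < p) a i) b.
Proof.
move=> cop; rewrite big_mkord; apply: (big_ind (coprime^~ b)) => [|x y|i _].
- exact: coprime1n.
- by rewrite coprimeMl => -> ->.
- exact: cop.
Qed.

Lemma coprime_dvdz_prod (p : nat) (a : nat -> nat) (x : int) :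
  (forall i j, (i < j < p)%N -> coprime (a i) (a j)) ->
  (forall i, (i < p)%N -> ((a i)%:Z %| x)%Z) ->
  ((\prod_(0 <= i < p) a i)%N%:Z %| x)%Z.
Proof.
move=> cop dv; rewrite dvdzE /=.
have {dv} : forall i, (i < p)%N -> (a i %| `|x|)%N.
  by move=> i /dv; rewrite dvdzE.
elim: p cop => [|p IH] cop dv; first by rewrite big_geq.
rewrite big_nat_recr//= Gauss_dvd ?dv//; last first.
  by apply: coprime_prod_nat => i ip; rewrite cop// ip/=.
rewrite andbT IH//= => [|i ip]; last by apply: dv; exact: ltnW.
by move=> i j /andP[ij jp]; apply: cop; rewrite ij ltnW.
Qed.

Lemma dvdn_prod_nat (p : nat) (a : nat -> nat) i :
  (i < p)%N -> (a i %| \prod_(0 <= j < p) a j)%N.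
Proof.
move=> ip; rewrite (@big_cat_nat _ _ _ i 0 p)//=; last exact: ltnW.
by rewrite [X in (_ %| _ * X)%N]big_ltn// dvdn_mull// dvdn_mulr.
Qed.

Lemma neg_inverse_mod (a : nat) (u : int) : (0 < a)%N -> coprimez u a ->
  exists r : nat, (r < a)%N /\ ((a%:Z) %| r%:Z * u + 1)%Z.
Proof.
move=> a0 /coprimezP[[x y]/= e].
exists `|((- x) %% a%:Z)%Z|%N.
have an : a%:Z != 0 by rewrite eqz_nat; apply: lt0n_neq0.
have p0 := modz_ge0 (- x) an.
split.
  by rewrite -ltz_nat gez0_abs// ltz_pmod// ltz_nat.
rewrite gez0_abs//.
have -> : ((- x) %% a%:Z)%Z = - x - ((- x) %/ a%:Z)%Z * a%:Z.
  by rewrite {2}(divz_eq (- x) a%:Z); ring.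
rewrite -e.
apply/dvdzP; exists (y - ((- x) %/ a%:Z)%Z * u).
by ring.
Qed.

(** The condition binds only at i = p: for i < p both the factor s_p of the
    tail product and a multiple of a_0 ... a_(p-1) are divisible by a_i.  So Q
    may be any member of one residue class modulo q. *)
Lemma next_denominator (p : nat) (a : nat -> nat) (n : nat -> int) (Y T : nat) :
  (0 < p)%N -> (0 < Y)%N -> (forall i, 0 < a i)%N ->
  (forall i j, (i < j <= p)%N -> coprime (a i) (a j)) ->
  coprimez (n p) (a p) ->
  let q := (\prod_(0 <= i < p.+1) a i)%N in
  let s := fun i => (Y * (q %/ a i))%N in
  exists Q : nat, [/\ (T < Q)%N, (Q <= T + 2 * q)%N &
    forall i, (i <= p)%N -> ((a i)%:Z %| Q%:Z * n i + (tail_prod s p i)%:Z)%Z].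
Proof.
move=> p0 Y0 a0 cop nap q s.
pose q0 := (\prod_(0 <= i < p) a i)%N.
have qE : q = (q0 * a p)%N by rewrite /q big_nat_recr.
have q00 : (0 < q0)%N by apply: prodn_gt0.
have cq0 : coprime q0 (a p).
  by apply: coprime_prod_nat => i ip; rewrite cop// ip/=.
have [|r [ra rd]] := @neg_inverse_mod (a p) (q0%:Z * n p) (a0 p).
  by rewrite coprimezMl nap andbT.
have q_gt0 : (0 < q)%N by rewrite qE muln_gt0 q00 a0.
exists (r * q0 + (T %/ q).+1 * q)%N; split.
- by rewrite (leq_trans (ltn_ceil T q_gt0))// leq_addl.
- have h1 : (r * q0 <= q)%N by rewrite qE mulnC leq_mul2l ltnW// orbT.
  have h2 := leq_trunc_div T q.
  rewrite mulSn; move: (r * q0)%N (T %/ q * q)%N h1 h2 => x y h1 h2.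
  by lia.
- move=> i; rewrite leq_eqVlt => /orP[/eqP ->|ip].
    rewrite tail_prod_last.
    have -> : (r * q0 + (T %/ q).+1 * q)%N%:Z * n p + 1 =
      (r%:Z * (q0%:Z * n p) + 1) + (((T %/ q).+1)%:Z * q0%:Z * n p) * (a p)%:Z.
      by rewrite PoszD !PoszM qE PoszM; ring.
    by apply: rpredD => //; exact: dvdz_mull.
  have d1 : (a i %| q0)%N by apply: dvdn_prod_nat.
  apply: rpredD.
    apply: dvdz_mulr; rewrite dvdzE/= dvdn_add// ?dvdn_mull//.
    by rewrite qE dvdn_mulr.
  rewrite dvdzE/=; apply: (@dvdn_trans (s p)); last first.
    by apply: dvdn_tail_prod; rewrite ip leqnn.
  by rewrite /s qE mulnK// dvdn_mull.
Qed.

(** Put X = Y q for a large integer Y, let a_i s_i = X, h_i = tail_prod s p i and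
    z_i = n_i / a_i + h_i / (a_i Q).  Then q z is within rho = X^p / Q of
    the integers, and rho <= 1 / X.  For 0 < k < Q, the distance of k z to the
    integers is that of a vector of the product of the (1/a_i) Z to a point of
    the line of l = (h_i / a_i).  Vectors off this line are at distance about
    1 / X or more by [almost_parallel]; those on it contribute rho or more,
    because k is not a multiple of Q.  The value Q rho^(p+1) is the p-th power
    of X^(p+1) / Q, which the free choice of Q puts as close to e as desired. *)
Lemma sharp_step (R : realType) (p : nat) (a : nat -> nat) (n : nat -> int)
    (e eta B : R) :
  (0 < p)%N -> (forall i, 0 < a i)%N ->
  (forall i j, (i < j <= p)%N -> coprime (a i) (a j)) ->
  (forall i, (i <= p)%N -> coprimez (n i) (a i)) ->
  0 < e <= 1 -> 0 < eta < 1 ->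
  let q := (\prod_(0 <= i < p.+1) a i)%N in
  exists (Q : nat) (rho : R) (z : nat -> R),
  [/\ B <= Q%:R, 0 < rho & B * rho <= 1] /\
  [/\ exists2 E, (1 - eta) * e <= E <= e & Q%:R * rho ^+ p.+1 = E ^+ p,
     forall i, (i <= p)%N -> exists P : int, Q%:R * z i = P%:~R,
     forall i, (i <= p)%N -> q%:R * `|z i - (n i)%:~R / (a i)%:R| <= rho &
     forall k : nat, (0 < k < Q)%N -> exists2 i, (i <= p)%N &
       forall w : int, (1 - eta) * rho <= `|k%:R * z i - w%:~R|].
Proof.
move=> p0 a0 cop nap /andP[e0 e1] /andP[eta0 eta1] q.
(* The term 3 / eta makes the rounding of Q (at most 2 q) and the slope of l
   negligible; the term |B| makes Q large. *)
pose Y := (Num.truncn (3 / eta + `|B|)).+1.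
have YB : 3 / eta + `|B| < Y%:R by apply: truncnS_gt.
pose s := fun i => (Y * (q %/ a i))%N.
pose h := tail_prod s p.
pose X := (Y * q)%N.
have q0 : (0 < q)%N by apply: prodn_gt0.
have aq i : (i <= p)%N -> (a i %| q)%N by move=> ip; apply: dvdn_prod_nat.
have s0 i : (i <= p)%N -> (0 < s i)%N.
  move=> ip; rewrite muln_gt0 divn_gt0; last exact: a0.
  by apply/andP; split=> //; rewrite dvdn_leq ?aq.
have as_ i : (i <= p)%N -> (a i * s i)%N = X.
  by move=> ip; rewrite /s mulnCA [(a i * _)%N]mulnC divnK// aq.
have h0 i : (0 < h i)%N by exact: tail_prod_gt0.
have qh : (q * h 0 = a 0 * X ^ p)%N.
  rewrite /q big_ltn// -mulnA; congr muln.
  rewrite /h /tail_prod -big_split/=.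
  rewrite (@eq_big_nat _ _ _ _ _ _ (fun=> X)) => [|i /andP[_ ip]].
    by rewrite prod_nat_const_nat subn1.
  by rewrite as_.
have Y0 : (0 < Y)%N by [].
pose T := Num.truncn (X%:R ^+ p.+1 / e : R).
have [Q [TQ QT dv]] := @next_denominator p a n Y T p0 Y0 a0 cop (nap p (leqnn p)).
rewrite -/q -/s -/h in QT dv.
have X0 : (0 < X)%N by rewrite muln_gt0 Y0.
have X1R : 1 <= X%:R :> R by rewrite ler1n.
have Xe0 : 0 <= (X%:R ^+ p.+1 / e : R) by rewrite divr_ge0// ?exprn_ge0// ltW.
have XQ : X%:R ^+ p.+1 <= e * Q%:R.
  rewrite mulrC -ler_pdivrMr//; apply/ltW/(lt_le_trans (truncnS_gt _)).
  by rewrite ler_nat.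
have QX : e * Q%:R <= X%:R ^+ p.+1 + 2 * q%:R.
  have : Q%:R <= X%:R ^+ p.+1 / e + 2 * q%:R :> R.
    rewrite (le_trans (_ : _ <= (T + 2 * q)%:R))// ?ler_nat//.
    by rewrite natrD natrM lerD2r truncn_le.
  rewrite -(ler_pM2l e0) mulrDr mulrCA divff ?gt_eqF// mulr1 => /le_trans; apply.
  by rewrite lerD2l ler_piMl.
have Q0 : 0 < Q%:R :> R by rewrite ltr0n (leq_ltn_trans _ TQ).
pose rho : R := X%:R ^+ p / Q%:R.
have rho0 : 0 < rho by rewrite divr_gt0// exprn_gt0// (lt_le_trans ltr01).
have Qrho : Q%:R * rho = X%:R ^+ p by rewrite mulrCA divff ?gt_eqF// mulr1.
have rhoX : rho * X%:R <= 1.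
  rewrite mulrAC ler_pdivrMr// -exprSr mul1r (le_trans XQ)//.
  by rewrite ler_piMl// ltW.
have q1R : 1 <= q%:R :> R by rewrite ler1n.
have XE : X%:R = Y%:R * q%:R :> R by rewrite natrM.
have e3 : 0 < 3 / eta by rewrite divr_gt0.
have YX : Y%:R <= X%:R :> R by rewrite XE ler_peMr.
have BX : B <= X%:R.
  rewrite (le_trans (ler_norm _))// (le_trans _ YX)//.
  by rewrite (le_trans _ (ltW YB))// lerDr ltW.
pose z := fun i => (n i)%:~R / (a i)%:R + (h i)%:R / ((a i)%:R * Q%:R) : R.
have aR i : 0 < (a i)%:R :> R by rewrite ltr0n.
have hR i : 0 < (h i)%:R :> R by rewrite ltr0n.
have etaY : 3 <= eta * Y%:R.
  rewrite mulrC -ler_pdivrMr// (le_trans _ (ltW YB))//.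
  by rewrite lerDl.
(* The vector l is almost parallel to the first axis: l_i <= l_0 / Y. *)
have small i : (0 < i <= p)%N ->
    (a 0)%:R * (h i)%:R * Y%:R <= (a i)%:R * (h 0)%:R :> R.
  move=> ip; have := @tail_prod_le_first s p i s0 ip; rewrite -/h => sh.
  rewrite -!natrM ler_nat (@leq_trans (X * h i))//.
    rewrite mulnAC leq_mul2r; apply/orP; right.
    by rewrite /X mulnC leq_mul2l dvdn_leq ?orbT// aq.
  by rewrite -(as_ i) ?(andP ip).2// -mulnA leq_mul2l sh orbT.
have Y1R : 1 <= Y%:R :> R by rewrite ler1n.
have le0 i : (i <= p)%N -> (a 0)%:R * (h i)%:R <= (a i)%:R * (h 0)%:R :> R.
  case: i => [//|i ip]; apply: le_trans (small i.+1 ip).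
  by rewrite ler_peMr// mulr_ge0.
have qhR : q%:R * (h 0)%:R = (a 0)%:R * X%:R ^+ p :> R.
  by rewrite -natrX -!natrM qh.
exists Q, rho, z; split; split => //.
- rewrite (le_trans BX)// (le_trans _ (le_trans XQ _))//.
    by rewrite exprS ler_peMr// exprn_ege1.
  by rewrite ler_piMl// ltW.
- apply: (le_trans _ rhoX); rewrite mulrC ler_pM2l//.
- exists (X%:R ^+ p.+1 / Q%:R).
    rewrite ler_pdivrMr// ler_pdivlMr// XQ andbT.
    rewrite -mulrA; apply: (le_trans (ler_wpM2l _ QX)); first lra.
    have : 2 * q%:R <= eta * X%:R ^+ p.+1.
      apply: (@le_trans _ _ (3 * q%:R)); first by rewrite ler_pM2r; lra.
      apply: (@le_trans _ _ (eta * X%:R)).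
        by rewrite XE mulrA ler_pM2r//; lra.
      by rewrite ler_pM2l// exprS ler_peMr// exprn_ege1.
    move: (X%:R ^+ p.+1) => x; move: (q%:R) q1R => y y1 xy; nra.
  by rewrite exprS mulrA Qrho !expr_div_n mulrA -exprS -!exprM mulnC.
- move=> i ip; have /dvdzP[c cE] := dv i ip.
  exists c; rewrite /z mulrDr; apply: (mulIf (lt0r_neq0 (aR i))).
  transitivity ((Q%:Z * n i + (h i)%:Z)%:~R : R); last by rewrite cE rmorphM.
  rewrite rmorphD rmorphM /=; field.
  by rewrite !gt_eqF.
- move=> i ip; rewrite /z addrC addKr ger0_norm; last first.
    by rewrite divr_ge0// mulr_ge0.
  rewrite mulrA ler_pdivrMr ?mulr_gt0//.
  have -> : rho * ((a i)%:R * Q%:R) = (a i)%:R * X%:R ^+ p by rewrite -Qrho; ring.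
  rewrite -(ler_pM2l (aR 0%N)) [leRHS]mulrCA -qhR [leRHS]mulrCA [leLHS]mulrCA.
  by rewrite ler_pM2l ?le0// (lt_le_trans ltr01).
- have rhoE : rho = X%:R ^+ p / Q%:R by [].
  clearbody rho; move=> k /andP[k0 kQ]; apply: contrapT => nex.
  have : forall i, exists w : int, (i <= p)%N ->
      `|k%:R * z i - w%:~R| < (1 - eta) * rho.
    move=> i; case: (leqP i p) => ip; last by exists 0.
    apply: contrapT => nw; apply: nex; exists i => // w.
    by rewrite leNgt; apply/negP => lt; apply: nw; exists w.
  move=> /choice[w wP].
  pose g i : int := k%:Z * n i - w i * (a i)%:Z.
  pose t : R := k%:R / Q%:R.
  pose u i : R := (g i)%:~R + t * (h i)%:R.
  have uE i : u i = (k%:R * z i - (w i)%:~R) * (a i)%:R.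
    rewrite /u /g /z /t rmorphB !rmorphM/=; field.
    by rewrite !gt_eqF.
  have ub i : (i <= p)%N -> `|u i| < (1 - eta) * rho * (a i)%:R.
    by move=> ip; rewrite uE normrM [X in _ * X]ger0_norm// ltr_pM2r// wP.
  (* The multiple t = k / Q of l is eliminated with coordinate 0, where l is
     longest, so this costs only a factor 1 + eta in the other coordinates. *)
  have gp : forall i, (i <= p)%N -> g i = g p * (h i)%:Z.
    apply: almost_parallel => // i ip; rewrite -/h.
    have ip' : (i <= p)%N by case/andP: ip.
    rewrite -(ltr_int R) rmorphM/= intr_norm rmorphB !rmorphM/=.
    have -> : (g i)%:~R * (h 0)%:R - (g 0)%:~R * (h i)%:R =
        u i * (h 0)%:R - u 0 * (h i)%:R :> R by rewrite /u; ring.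
    have h1 := ub i ip'; have h2 := ub 0%N (leq0n p).
    have h3 : `|u i * (h 0)%:R - u 0 * (h i)%:R| <=
        `|u i| * (h 0)%:R + `|u 0| * (h i)%:R :> R.
      by rewrite (le_trans (ler_normB _ _))// !normrM !(@ger0_norm _ _%:R).
    have h4 : (a 0)%:R * (h i)%:R <= eta * ((a i)%:R * (h 0)%:R) :> R.
      have h4 := small i ip.
      have : eta * ((a 0)%:R * (h i)%:R * Y%:R) <= eta * ((a i)%:R * (h 0)%:R).
        by rewrite ler_pM2l.
      apply: le_trans; rewrite mulrCA ler_peMr ?mulr_ge0//; lra.
    have h5 : `|u i * (h 0)%:R - u 0 * (h i)%:R| <=
        (1 - eta) * rho * ((1 + eta) * ((a i)%:R * (h 0)%:R)).
      apply: (le_trans h3).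
      apply: (@le_trans _ _ ((1 - eta) * rho * ((a i)%:R * (h 0)%:R
           + (a 0)%:R * (h i)%:R))).
        by rewrite mulrDr !mulrA; apply: lerD; rewrite ler_pM2r// ltW.
      by rewrite ler_pM2l ?mulr_gt0//; lra.
    have si0 : 0 < (s i)%:R :> R by rewrite ltr0n s0.
    apply: (le_lt_trans (ler_wpM2r (ltW si0) h5)).
    have aX : (a i)%:R * (s i)%:R = X%:R :> R by rewrite -natrM as_.
    have -> : (1 - eta) * rho * ((1 + eta) * ((a i)%:R * (h 0)%:R)) * (s i)%:R
       = (1 - eta ^+ 2) * (rho * X%:R) * (h 0)%:R by rewrite -aX; ring.
    rewrite gtr_pMl//; apply: (le_lt_trans (_ : _ <= 1 - eta ^+ 2)).
      by rewrite ler_piMr//; nra.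
    by rewrite gtrDl oppr_lt0 exprn_gt0.
  pose j := g p.
  (* On the line of l, the integer j Q + k is divisible by q; it is nonzero since
     0 < k < Q, so coordinate 0 is off by at least q l_0 / Q = rho. *)
  have dvj i : (i < p.+1)%N -> ((a i)%:Z %| j * Q%:Z + k%:Z)%Z.
    rewrite ltnS => ip.
    have e2 : (j * Q%:Z + k%:Z) * n i = j * (Q%:Z * n i + (h i)%:Z)
      + w i * (a i)%:Z.
      have : g i = j * (h i)%:Z := gp i ip.
      rewrite /g => /eqP; rewrite subr_eq => /eqP e2.
      by rewrite mulrDl e2; ring.
    have := nap i ip; rewrite coprimez_sym => co.
    rewrite -(Gauss_dvdzl _ co) e2; apply: rpredD; last exact: dvdz_mull.
    by apply: dvdz_mull; apply: dv.
  have := @coprime_dvdz_prod p.+1 a (j * Q%:Z + k%:Z) cop dvj.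
  rewrite -/q => /dvdzP[c cE].
  have cn0 : c != 0.
    apply/eqP => c0; move: cE; rewrite c0 mul0r => /eqP; rewrite addr_eq0 => /eqP.
    case: (leP 0 j) => [jge|jlt] jQ.
      have : 0 <= - k%:Z by rewrite -jQ mulr_ge0.
      by rewrite oppr_ge0 lez_nat leqNgt k0.
    have : - k%:Z <= (-1) * Q%:Z by rewrite -jQ ler_wpM2r// -ltzD1 addNr.
    by rewrite mulN1r lerN2 lez_nat leqNgt kQ.
  have := ub 0%N (leq0n p).
  have -> : u 0%N = c%:~R * q%:R * (h 0)%:R / Q%:R.
    have -> : c%:~R * q%:R = (j * Q%:Z + k%:Z)%:~R :> R by rewrite cE rmorphM.
    rewrite /u (gp 0%N)// -/j /t rmorphD !rmorphM/=; field.
    by rewrite gt_eqF.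
  have -> : c%:~R * q%:R * (h 0%N)%:R / Q%:R = c%:~R * (rho * (a 0%N)%:R).
    by rewrite -[c%:~R * _ * _]mulrA qhR rhoE; ring.
  rewrite normrM [X in _ * X]ger0_norm ?mulr_ge0// ?ltW//.
  have : 1 <= `|c%:~R : R| by rewrite -intr_norm ler1z -gtz0_ge1 normr_gt0.
  move=> c1; apply/negP; rewrite -leNgt.
  apply: (@le_trans _ _ (rho * (a 0%N)%:R)); last by rewrite ler_peMl// mulr_ge0// ltW.
  by rewrite -mulrA ger_pMl ?mulr_gt0// gerBl ltW.
Qed.

(** * Limits at infinity, bounds on psi, Dirichlet's theorem *)

Lemma limf_esup_eq (R : realType) (f : R -> R) (c : R) :
  (forall e, 0 < e -> exists Q0, forall Q, Q0 <= Q -> f Q <= c + e) ->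
  (forall e Q0, 0 < e -> exists2 Q, Q0 <= Q & c - e <= f Q) ->
  limf_esup (fun Q : R => (f Q)%:E) (pinfty_nbhs R) = c%:E.
Proof.
move=> ub lb; apply/eqP; rewrite eq_le; apply/andP; split.
  apply/lee_addgt0Pr => e e0; have [Q0 Q0P] := ub e e0.
  apply: (@le_trans _ _ (ereal_sup ((fun Q : R => (f Q)%:E) @` [set Q | Q0 < Q]))).
    apply: ereal_inf_lbound; exists [set Q | Q0 < Q] => //.
    by exists Q0; split => //; exact: num_real.
  apply: ge_ereal_sup => _ [Q /= /ltW QQ <-].
  by rewrite -EFinD lee_fin Q0P.
apply: le_ereal_inf_tmp => _ [V [M [_ MV]] <-].
apply/lee_addgt0Pr => e e0; have [Q QM Qe] := lb e (M + 1) e0.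
apply: (@le_trans _ _ ((f Q)%:E + e%:E)); first by rewrite -EFinD lee_fin -lerBlDr.
rewrite leeD2r//; apply: ereal_sup_ubound; exists Q => //.
by apply: MV; apply: lt_le_trans QM; rewrite ltrDl.
Qed.

Lemma limf_einf_eq0 (R : realType) (f : R -> R) :
  (forall Q, 0 <= f Q) ->
  (forall e Q0, 0 < e -> exists2 Q, Q0 <= Q & f Q <= e) ->
  limf_einf (fun Q : R => (f Q)%:E) (pinfty_nbhs R) = 0%E.
Proof.
move=> f0 lb; apply: oppe_inj; rewrite -limf_esupN oppe0.
apply: (@limf_esup_eq _ (fun Q => - f Q)).
  by move=> e e0; exists 0 => Q _; rewrite add0r (le_trans _ (ltW e0))// oppr_le0.
move=> e Q0 e0; have [Q QQ fQ] := lb e Q0 e0.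
by exists Q => //; rewrite sub0r lerN2.
Qed.

Section PsiBounds.
Variable R : realType.

Lemma dist_int_le (x v : R) (n : int) : `|x - n%:~R| <= v -> dist_int x <= v.
Proof.
move=> h; apply: le_trans h; apply: ge_inf; last by exists n.
by exists 0 => _ [k _ <-].
Qed.

Lemma dist_int_ge (x v : R) : (forall n : int, v <= `|x - n%:~R|) ->
  v <= dist_int x.
Proof.
move=> h; apply: lb_le_inf; last by move=> _ [n _ <-].
by exists `|x - 0%:~R|; exists 0.
Qed.

Lemma psi_has_inf m (xi : 'rV[R]_m) (Q : R) : 1 <= Q ->
  has_inf [set dist_intv (q%:R *: xi) | q in [set q : nat | (1 <= q)%N /\ q%:R <= Q]].
Proof.
move=> Q1; split; first by exists (dist_intv (1%:R *: xi)); exists 1%N.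
by exists 0 => _ [q _ <-]; apply: bigmax_ge_id.
Qed.

Lemma psi_le m (xi : 'rV[R]_m) (k : nat) (Q v : R) :
  (0 < k)%N -> k%:R <= Q -> 0 <= v ->
  (forall i, exists z : int, `|k%:R * xi ord0 i - z%:~R| <= v) ->
  psi xi Q <= v.
Proof.
move=> k0 kQ v0 h; apply: (@le_trans _ _ (dist_intv (k%:R *: xi))).
  apply: ge_inf; last by exists k.
  apply: (psi_has_inf _ _ _ _).2; apply: le_trans kQ.
  by rewrite ler1n.
apply: bigmax_le => // i _; have [z hz] := h i.
by apply: dist_int_le; rewrite mxE; exact: hz.
Qed.

Lemma psi_ge m (xi : 'rV[R]_m) (Q v : R) : 1 <= Q ->
  (forall k : nat, (0 < k)%N -> k%:R <= Q ->
    exists i, forall z : int, v <= `|k%:R * xi ord0 i - z%:~R|) ->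
  v <= psi xi Q.
Proof.
move=> Q1 h; apply: lb_le_inf; first exact: (psi_has_inf _ _ _ Q1).1.
move=> _ [k [k0 kQ] <-]; have [i hi] := h k k0 kQ.
apply: le_trans (le_bigmax _ _ i).
by apply: dist_int_ge => n; rewrite mxE.
Qed.

Lemma psi_ge0 m (xi : 'rV[R]_m) (Q : R) : 0 <= psi xi Q.
Proof.
rewrite /psi; set S := (X in inf X).
have [h|h] := pselect (has_inf S); last by rewrite inf_out.
by apply: lb_le_inf => [|_ [q _ <-]]; [exact: h.1 | exact: bigmax_ge_id].
Qed.

(** Pigeonhole for the points 0, x, ..., N^p x modulo 1 and the N^p cubes of
    side 1 / N. *)
Lemma dirichlet (p N : nat) (x : 'I_p -> R) : (0 < N)%N ->
  exists k : nat, (0 < k <= N ^ p)%N /\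
    forall i, exists z : int, `|k%:R * x i - z%:~R| <= N%:R^-1.
Proof.
case: N => // N _.
pose fr (y : R) := y - (Num.floor y)%:~R.
have fr01 y : 0 <= fr y < 1.
  have := floorD1_gt y; rewrite rmorphD/= => h.
  by rewrite /fr subr_ge0 floor_le_tmp ltrBlDl.
pose F (k : 'I_(N.+1 ^ p).+1) : {ffun 'I_p -> 'I_N.+1} :=
  [ffun i => inord (Num.truncn (N.+1%:R * fr (k%:R * x i)))].
have Fval k i : (F k i)%:R <= N.+1%:R * fr (k%:R * x i) < (F k i)%:R + 1.
  have /andP[f0 f1] := fr01 (k%:R * x i).
  have n0 : 0 <= N.+1%:R * fr (k%:R * x i) by rewrite mulr_ge0.
  rewrite ffunE inordK; last by rewrite truncn_lt_nat// gtr_pMr// ltr0n.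
  by rewrite natr1 truncn_itv.
have [/injectiveP inj|] := boolP (injectiveb F).
  have := leq_card F inj; rewrite card_ffun !card_ord.
  by rewrite ltnn.
move=> /injectivePn[k [l kl Fkl]].
wlog : k l kl Fkl / (k < l)%N => [W|{kl} kl].
  have : (k < l)%N || (l < k)%N by rewrite -neq_ltn.
  by case/orP; [apply: W|apply: W => //; rewrite eq_sym].
exists (l - k)%N; split.
  by rewrite subn_gt0 kl/= (leq_trans (leq_subr _ _))// -ltnS.
move=> i; exists (Num.floor (l%:R * x i) - Num.floor (k%:R * x i)).
have -> : (l - k)%N%:R * x i
  - (Num.floor (l%:R * x i) - Num.floor (k%:R * x i))%:~R
  = fr (l%:R * x i) - fr (k%:R * x i).
  by rewrite natrB ?(ltnW kl)// rmorphB/= /fr; ring.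
have /andP[a1 a2] := Fval k i; have /andP[b1 b2] := Fval l i.
rewrite -Fkl in b1 b2.
rewrite -[leRHS]mul1r ler_pdivlMr ?ltr0n// -[N.+1%:R]ger0_norm// -normrM mulrC.
rewrite mulrBr; move: b1 b2 a1 a2; set u := _ * fr _; set v := _ * fr _.
move: (_%:R) => w *; rewrite ler_norml; apply/andP; split; lra.
Qed.

End PsiBounds.

Section HyperplaneDirichlet.
Variable R : realType.
Implicit Types (Q c e : R).

Lemma mroot_expK (m : nat) Q : (0 < m)%N -> 0 <= Q ->
  (Q `^ (m%:R^-1)) ^+ m = Q.
Proof.
move=> m0 Q0; rewrite -powR_mulrn ?powR_ge0// -powRrM mulVf ?powRr1//.
by rewrite pnatr_eq0 -lt0n.
Qed.

Lemma le_mroot (m : nat) Q v e : (0 < m)%N -> 0 <= Q -> 0 <= v -> 0 <= e ->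
  (Q `^ (m%:R^-1) * v <= e) = (Q * v ^+ m <= e ^+ m).
Proof.
move=> m0 Q0 v0 e0; rewrite -{2}(mroot_expK _ Q m0 Q0) -exprMn ler_pXn2r//.
by rewrite nnegrE mulr_ge0// powR_ge0.
Qed.

Lemma ge_mroot (m : nat) Q v e : (0 < m)%N -> 0 <= Q -> 0 <= v -> 0 <= e ->
  (e <= Q `^ (m%:R^-1) * v) = (e ^+ m <= Q * v ^+ m).
Proof.
move=> m0 Q0 v0 e0; rewrite -{2}(mroot_expK _ Q m0 Q0) -exprMn ler_pXn2r//.
by rewrite nnegrE mulr_ge0// powR_ge0.
Qed.

Lemma mroot_le (m : nat) Q : (0 < m)%N -> 1 <= Q -> Q `^ (m%:R^-1) <= Q.
Proof. by move=> m0 Q1; rewrite ler1_powR// invf_le1 ?ler1n// ltr0n. Qed.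

Lemma nat_root (p : nat) Q : (0 < p)%N -> 0 <= Q ->
  exists N : nat, N%:R ^+ p <= Q < N.+1%:R ^+ p.
Proof.
move=> p0 Q0; exists (Num.truncn (Q `^ p%:R^-1)).
have /andP[h1 h2] := truncn_itv (powR_ge0 Q p%:R^-1).
rewrite -{2 3}(mroot_expK p Q p0 Q0); apply/andP; split.
  by rewrite lerXn2r// nnegrE// powR_ge0.
by rewrite ltrXn2r ?nnegrE ?powR_ge0// -lt0n p0.
Qed.

Lemma exists_root (p : nat) Q : (0 < p)%N -> 0 <= Q -> exists2 e, 0 <= e & e ^+ p = Q.
Proof.
by move=> p0 Q0; exists (Q `^ p%:R^-1); [exact: powR_ge0|exact: mroot_expK].
Qed.

Lemma psi_perturb m (xi y : 'rV[R]_m) (k : nat) Q v d :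
  (0 < k)%N -> k%:R <= Q -> 0 <= v -> 0 <= d ->
  (forall i, exists z : int, `|k%:R * y ord0 i - z%:~R| <= v) ->
  (forall i, `|xi ord0 i - y ord0 i| <= d) ->
  psi xi Q <= v + k%:R * d.
Proof.
move=> k0 kQ v0 d0 h c.
apply: (@psi_le _ _ xi k) => //; first by rewrite addr_ge0// mulr_ge0.
move=> i; have [z hz] := h i; exists z.
have -> : k%:R * xi ord0 i - z%:~R =
   (k%:R * y ord0 i - z%:~R) + k%:R * (xi ord0 i - y ord0 i) by ring.
by rewrite (le_trans (ler_normD _ _))// lerD// normrM ger0_norm// ler_wpM2l.
Qed.

(** On the hyperplane y_0 = P / q, Dirichlet's theorem in dimension p for the
    remaining coordinates, after multiplication by q, gives the exponent 1 / p.
    This beats 1 / (p + 1) and the constant coming from q once Q is large, with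
    a threshold independent of y. *)
Lemma hyperplane_dirichlet (p q : nat) e : (0 < p)%N -> (0 < q)%N -> 0 < e ->
  exists2 Q0, 1 <= Q0 & forall (y : 'rV[R]_p.+1) Q,
    q%:R * y ord0 ord0 \is a Num.int -> Q0 <= Q ->
    exists k : nat, exists2 v, [/\ (0 < k)%N, k%:R <= Q, 0 <= v &
        Q `^ (p.+1%:R^-1) * v <= e] &
      forall i, exists z : int, `|k%:R * y ord0 i - z%:~R| <= v.
Proof.
move=> p0 q0 e0.
(* If q N^p <= Q < q (2 N)^p and v = q / N, then
   Q v^(p+1) <= 2^p q^(p+2) / N, which N0 makes at most e^(p+1). *)
pose N0 := (Num.truncn (2 ^+ p * q%:R ^+ p.+2 / e ^+ p.+1)).+1.
have q1 : 1 <= q%:R :> R by rewrite ler1n.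
have qp : 0 < q%:R :> R by rewrite ltr0n.
exists (q%:R * N0%:R ^+ p); first by rewrite mulr_ege1// exprn_ege1// ler1n.
move=> y Q /intrP[P yP] Q0Q.
have Qq : N0%:R ^+ p <= Q / q%:R by rewrite ler_pdivlMr// mulrC.
have [|N /andP[NQ QN]] := @nat_root p (Q / q%:R) p0.
  by apply: le_trans Qq; rewrite exprn_ge0.
have N0N : (N0 <= N)%N.
  rewrite -ltnS -(ltr_nat R).
  by have := le_lt_trans Qq QN; rewrite ltr_pXn2r ?nnegrE.
have N_gt0 : (0 < N)%N by exact: leq_trans N0N.
have NR : 0 < N%:R :> R by rewrite ltr0n.
have [k [/andP[k0 kN] kP]] := dirichlet _ _ N (fun i => y ord0 (lift ord0 i)) N_gt0.
exists (k * q)%N, (q%:R / N%:R); first split.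
- by rewrite muln_gt0 k0.
- rewrite natrM -ler_pdivlMr//; apply: le_trans NQ.
  by rewrite -natrX ler_nat.
- by rewrite divr_ge0.
- rewrite le_mroot// ?divr_ge0// ?(ltW e0)//; last first.
    by rewrite (le_trans _ Q0Q)// mulr_ge0// exprn_ge0.
  have Q2 : Q <= q%:R * (2 * N%:R) ^+ p.
    rewrite mulrC -ler_pdivrMr//; apply/ltW/(lt_le_trans QN).
    by rewrite lerXn2r ?nnegrE ?mulr_ge0// -natrM ler_nat mul2n -addnn -addn1 leq_add2l.
  apply: (le_trans (ler_wpM2r _ Q2)); first by rewrite exprn_ge0// divr_ge0.
  have -> : q%:R * (2 * N%:R) ^+ p * (q%:R / N%:R) ^+ p.+1 =
      2 ^+ p * q%:R ^+ p.+2 / N%:R :> R.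
    rewrite exprMn expr_div_n !exprS; field.
    by rewrite expf_eq0 gt_eqF// andbF.
  rewrite ler_pdivrMr// [leRHS]mulrC -ler_pdivrMr ?exprn_gt0//.
  by apply/ltW/(lt_le_trans (truncnS_gt _)); rewrite ler_nat.
- move=> i; case: (unliftP ord0 i) => [j ->|->]; last first.
    exists (k%:Z * P); rewrite natrM -mulrA yP rmorphM/= subrr normr0.
    by rewrite divr_ge0.
  have [z zP] := kP j; exists (q%:Z * z).
  have -> : (k * q)%:R * y ord0 (lift ord0 j) - (q%:Z * z)%:~R =
     q%:R * (k%:R * y ord0 (lift ord0 j) - z%:~R).
    by rewrite natrM intrM; ring.
  by rewrite normrM ger0_norm// ler_wpM2l.
Qed.
End HyperplaneDirichlet.

(** * Peaks that persist in a neighbourhood *)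

Lemma reduce_fraction (b : nat) (P : int) : (0 < b)%N ->
  exists (a : nat) (n : int),
    [/\ (0 < a)%N, (a %| b)%N, coprimez n a & n * b%:Z = P * a%:Z].
Proof.
move=> b0; pose g := gcdn `|P| b.
have g0 : (0 < g)%N by rewrite gcdn_gt0 b0 orbT.
have gb : (g %| b)%N by rewrite dvdn_gcdr.
have gP : (g%:Z %| P)%Z by rewrite dvdzE/= dvdn_gcdl.
have [n nE] := dvdzP gP; have [a aE] := dvdnP gb.
have a0 : (0 < a)%N by move: b0; rewrite aE muln_gt0 => /andP[].
exists a, n; split => //.
- by rewrite aE dvdn_mulr.
- have : gcdn `|P| b = g by [].
  rewrite nE {1}aE abszM/= -muln_gcdl -[RHS]mul1n => /eqP.
  by rewrite eqn_pmul2r.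
- by rewrite nE aE PoszM; ring.
Qed.

Section SharpPoint.
Variable R : realType.

(** The root r of r^p = c^(p+1) turns [sharp_step] into a peak of height c: there
    Q rho^(p+1) is about r^p.  The peak is read at T = Q - 1, where only the
    denominators below Q count, and by continuity it is shared by all xi close
    enough to z. *)
Lemma sharp_point (p : nat) (y : 'rV[R]_p.+1) (b : nat -> nat) (c e : R) :
  (0 < p)%N -> (forall i, (i <= p)%N -> 0 < b i)%N ->
  (forall i j, (i < j <= p)%N -> coprime (b i) (b j)) ->
  (forall i : 'I_p.+1, (b i)%:R * y ord0 i \is a Num.int) ->
  0 < c <= 1 -> 0 < e ->
  exists2 qy : nat, (0 < qy)%N & forall B : R,
  exists (Q : nat) (z : 'rV[R]_p.+1) (d : R),
  [/\ 0 < d, B <= Q%:R, forall i, Q%:R * z ord0 i \is a Num.int,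
    forall i, B * `|z ord0 i - y ord0 i| <= 1 &
    forall xi : 'rV[R]_p.+1, (forall i, `|xi ord0 i - z ord0 i| <= d) ->
      (forall T : R, qy%:R <= T -> T <= Q%:R ->
         T `^ (p.+1%:R^-1) * psi xi T <= c + e) /\
      (exists2 T : R, B <= T &
         c - e <= T `^ (p.+1%:R^-1) * psi xi T)].
Proof.
move=> p0 b0 bco yb /andP[c0 c1] e0.
have : forall i, exists an : nat * int, (0 < an.1)%N /\ ((i <= p)%N ->
    [/\ (an.1 %| b i)%N, coprimez an.2 an.1 &
      y ord0 (inord i) = an.2%:~R / an.1%:R]).
  move=> i; have [ip|pi] := leqP i p; last by exists (1%N, 0).
  have /intrP[P] := yb (inord i); rewrite inordK// => yP.
  have [a [n [a0 ab na nP]]] := reduce_fraction (b i) P (b0 i ip).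
  exists (a, n); split => // _; split => //=.
  have bR : (b i)%:R != 0 :> R by rewrite pnatr_eq0 -lt0n b0.
  have aR : a%:R != 0 :> R by rewrite pnatr_eq0 -lt0n.
  apply: (mulfI bR); rewrite yP; apply: (mulIf aR).
  have : n%:~R * (b i)%:R = P%:~R * a%:R :> R.
    have : (n * (b i)%:Z)%:~R = (P * a%:Z)%:~R :> R by rewrite nP.
    by rewrite !intrM.
  by move=> <-; rewrite -mulrA divfK// mulrC.
move=> /choice[an anP].
pose a i := (an i).1; pose n i := (an i).2.
have a0 i : (0 < a i)%N by have [] := anP i.
have aco i j : (i < j <= p)%N -> coprime (a i) (a j).
  move=> /andP[ij jp]; have [_ /(_ (leq_trans (ltnW ij) jp))[d1 _ _]] := anP i.
  have [_ /(_ jp)[d2 _ _]] := anP j.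
  apply: coprime_dvdl d1 _; apply: coprime_dvdr d2 _.
  by rewrite bco// ij.
have na i : (i <= p)%N -> coprimez (n i) (a i).
  by move=> ip; have [_ /(_ ip)[]] := anP i.
pose qy := (\prod_(0 <= i < p.+1) a i)%N.
have qy0 : (0 < qy)%N by apply: prodn_gt0.
have yE (i : 'I_p.+1) : y ord0 i = (n i)%:~R / (a i)%:R.
  have [_ /(_ _)[|_ _]] := anP i; first by rewrite -ltnS.
  by rewrite inord_val.
have qyint i : qy%:R * y ord0 i \is a Num.int.
  have /dvdnP[k kE] : (a i %| qy)%N by apply: dvdn_prod_nat.
  apply/intrP; exists (k%:Z * n i); rewrite yE kE natrM intrM; field.
  by rewrite pnatr_eq0 -lt0n a0.
exists qy => // B.
(* The lower bound loses eta three times: in rho, in the passage from Q to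
   Q - 1 together with the rounding of Q, and in the passage from z to xi. *)
pose eta : R := Num.min 2^-1 (e / 3).
have eta0 : 0 < eta by rewrite lt_min divr_gt0// invr_gt0 ltr0n.
have eta1 : eta < 1 by rewrite gt_min; apply/orP; left; rewrite invf_lt1// ltr1n.
have etae : 3 * eta <= e by rewrite mulrC -ler_pdivlMr// ge_min lexx orbT.
have [r r0 rE] := exists_root R p (c ^+ p.+1) p0 (exprn_ge0 _ (ltW c0)).
have r_gt0 : 0 < r.
  rewrite lt0r r0 andbT; apply/eqP => r00; move: rE.
  rewrite r00 expr0n gtn_eqF// => /esym/eqP; rewrite expf_eq0 gt_eqF//.
have r1 : r <= 1.
  by rewrite -(@ler_pXn2r _ p)// ?nnegrE// expr1n rE exprn_ile1// ltW.
pose B' := Num.max (Num.max (`|B| + 1) (qy%:R + 1)) eta^-1.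
have BB1 : `|B| + 1 <= B' by rewrite !le_max lexx.
have BB' : `|B| <= B' by apply: le_trans BB1; rewrite lerDl.
have qB' : qy%:R + 1 <= B' by rewrite !le_max lexx orbT.
have eB' : eta^-1 <= B' by rewrite !le_max lexx orbT.
have r01 : 0 < r <= 1 by rewrite r_gt0 r1.
have eta01 : 0 < eta < 1 by rewrite eta0 eta1.
have [Q [rho [zf [[BQ rho0 Brho] [[E /andP[E1 E2] EE] zint zy low]]]]] :=
  @sharp_step R p a n r eta B' p0 a0 aco na r01 eta01.
rewrite -/qy in zy.
pose z : 'rV[R]_p.+1 := \row_i zf i.
have Qy : (qy < Q)%N.
  by rewrite -(ltr_nat R) (lt_le_trans _ BQ)// (lt_le_trans _ qB')// ltrDl.
have QR : 0 < Q%:R :> R by rewrite ltr0n (leq_trans _ Qy).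
have Q1 : 1 <= Q%:R :> R by rewrite ler1n (leq_trans _ Qy).
pose d := eta / Q%:R ^+ 2.
have d0 : 0 < d by rewrite divr_gt0// exprn_gt0.
have QQd : Q%:R * (Q%:R * d) = eta.
  by rewrite mulrA -expr2 mulrC divfK// gt_eqF// exprn_gt0.
exists Q, z, d; split => //.
- by rewrite (le_trans (ler_norm B))// (le_trans BB').
- by move=> i; apply/intrP; rewrite mxE; apply: zint; rewrite -ltnS.
- move=> i; apply: le_trans Brho; apply: (@le_trans _ _ (B' * `|z ord0 i - y ord0 i|)).
    by rewrite ler_wpM2r// (le_trans _ BB')// ler_norm.
  rewrite ler_wpM2l//; first by rewrite (le_trans _ BB').
  have := zy i; rewrite -ltnS ltn_ord mxE yE => /(_ isT); apply: le_trans.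
  by rewrite ler_peMl// ler1n.
- move=> xi xiz.
  have E0 : 0 <= E by rewrite (le_trans _ E1)// mulr_ge0// ltW// subr_gt0.
  split.
    move=> T qT TQ.
    have T1 : 1 <= T by rewrite (le_trans _ qT)// ler1n.
    have up : psi xi T <= rho + Q%:R * d.
      apply: (@psi_le _ _ xi qy) => //.
        by rewrite addr_ge0 ?mulr_ge0// ltW.
      move=> i; have /intrP[P PE] := qyint i; exists P.
      have -> : qy%:R * xi ord0 i - P%:~R =
          qy%:R * (z ord0 i - y ord0 i) + qy%:R * (xi ord0 i - z ord0 i).
        by rewrite -PE; ring.
      rewrite (le_trans (ler_normD _ _))// lerD//.
        rewrite normrM ger0_norm// mxE yE; apply: zy.
        by rewrite -ltnS.
      by rewrite normrM ger0_norm// ler_pM// ler_nat ltnW.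
    apply: (@le_trans _ _ (Q%:R `^ p.+1%:R^-1 * (rho + Q%:R * d))).
      apply: ler_pM => //; [exact: powR_ge0|exact: psi_ge0|].
      by rewrite ge0_ler_powR// nnegrE// (le_trans _ T1).
    rewrite mulrDr; apply: lerD.
      rewrite le_mroot//; [|exact: ltW|exact: ltW].
      by rewrite EE -rE lerXn2r// nnegrE.
    apply: (@le_trans _ _ (Q%:R * (Q%:R * d))).
      by apply: ler_wpM2r; [rewrite mulr_ge0// ltW|exact: mroot_le].
    by rewrite QQd (le_trans _ etae)// ler_peMl ?ler1n// ltW.
  have Qn0 : (0 < Q)%N by rewrite (leq_trans _ Qy).
  have QB1 : 1 <= eta * Q%:R.
    by rewrite -ler_pdivrMl// mulr1 (le_trans eB').
  have Qm1 : Q.-1%:R = Q%:R - 1 :> R by rewrite -subn1 natrB.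
  exists (Q.-1%:R).
    by rewrite (le_trans (ler_norm B))// Qm1 lerBrDr (le_trans BB1).
  have Qm11 : 1 <= Q.-1%:R :> R.
    by rewrite ler1n -ltnS prednK// (leq_ltn_trans _ Qy).
  have lo : (1 - eta) * rho - Q%:R * d <= psi xi Q.-1%:R.
    apply: psi_ge => // k k0; rewrite ler_nat => kQ.
    have [|i ip zi] := low k; first by rewrite k0 -(prednK Qn0) ltnS.
    exists (inord i) => w.
    have := zi w; have -> : zf i = z ord0 (inord i) by rewrite mxE inordK.
    move=> {}zi; rewrite lerBlDr (le_trans zi)//.
    have -> : k%:R * z ord0 (inord i) - w%:~R =
        (k%:R * xi ord0 (inord i) - w%:~R) + k%:R * (z ord0 (inord i) - xi ord0 (inord i)).
      by ring.
    rewrite (le_trans (ler_normD _ _))// lerD2l normrM ger0_norm// ler_pM//.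
      by rewrite ler_nat (leq_trans kQ)// leq_pred.
    by rewrite distrC.
  apply: le_trans (ler_wpM2l (powR_ge0 _ _) lo); rewrite mulrBr.
  have h2 : Q.-1%:R `^ p.+1%:R^-1 * (Q%:R * d) <= eta.
    rewrite -[leRHS]QQd; apply: ler_wpM2r; first by rewrite mulr_ge0// ltW.
    apply: (@le_trans _ _ Q.-1%:R); first exact: mroot_le.
    by rewrite ler_nat leq_pred.
  have h1 : (1 - eta) ^+ 2 * c <= Q.-1%:R `^ p.+1%:R^-1 * ((1 - eta) * rho).
    have ge1 : 0 <= 1 - eta by rewrite subr_ge0 ltW.
    rewrite ge_mroot// ?mulr_ge0 ?exprn_ge0 ?(ltW c0) ?(ltW rho0)//.
    have -> : ((1 - eta) ^+ 2 * c) ^+ p.+1 =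
        (1 - eta) ^+ p.+1 * ((1 - eta) ^+ p.+1 * c ^+ p.+1).
      by rewrite exprMn -exprM mulnC exprM [X in X * _]expr2 mulrA.
    rewrite [in leRHS]exprMn [leRHS]mulrCA ler_wpM2l ?exprn_ge0//.
    apply: (@le_trans _ _ ((1 - eta) * (Q%:R * rho ^+ p.+1))).
      rewrite EE -rE exprS -mulrA ler_wpM2l// -exprMn lerXn2r// nnegrE//.
      by rewrite mulr_ge0.
    rewrite mulrA ler_wpM2r ?exprn_ge0 ?(ltW rho0)//.
    by rewrite Qm1 mulrBl mul1r lerD2l lerN2.
  have h3 : c - 2 * eta <= (1 - eta) ^+ 2 * c.
    clear -eta0 eta1 c0 c1; rewrite -subr_ge0.
    have -> : (1 - eta) ^+ 2 * c - (c - 2 * eta) =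
       2 * (eta * (1 - c)) + eta ^+ 2 * c by ring.
    by rewrite addr_ge0 ?mulr_ge0 ?exprn_ge0 ?subr_ge0// ltW.
  move: h1 h2 h3 etae; clear.
  by move: (_ `^ _ * _) (_ `^ _ * _) (_ * c) => x1 x2 x3 h1 h2 h3 h4; lra.
Qed.
End SharpPoint.

(** * Moving inside a rational hyperplane *)

Definition near_pt {R : realType} {p : nat} (w xi : 'rV[R]_p) (t : R) : Prop :=
  forall i, `|xi ord0 i - w ord0 i| <= t.

(** A common divisor divides l - k, hence p! and D, hence 1. *)
Lemma coprime_progression (D p k l : nat) : (p`! %| D)%N -> (k < l <= p)%N ->
  coprime (1 + k * D) (1 + l * D).
Proof.
move=> pD /andP[kl lp].
set d := gcdn (1 + k * D) (1 + l * D).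
have dk : (d %| 1 + k * D)%N by apply: dvdn_gcdl.
have dl : (d %| 1 + l * D)%N by apply: dvdn_gcdr.
have dkl : (d %| l - k)%N.
  have -> : (l - k = l * (1 + k * D) - k * (1 + l * D))%N.
    by rewrite !mulnDr !muln1 [(l * (k * D))%N]mulnCA subnDr.
  by apply: dvdn_sub; apply: dvdn_mull.
have dD : (d %| D)%N.
  apply: dvdn_trans dkl (dvdn_trans _ pD).
  by apply: dvdn_fact; rewrite subn_gt0 kl/= (leq_trans (leq_subr _ _)).
have : (d %| 1)%N.
  by rewrite -(@dvdn_addl (k * D)) ?dvdn_mull.
by rewrite dvdn1.
Qed.

Section Grid.
Variable R : realType.

Lemma near_ptD p (w y xi : 'rV[R]_p) s t u : s + t <= u ->
  near_pt w y s -> near_pt y xi t -> near_pt w xi u.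
Proof.
move=> stu h1 h2 i; apply: le_trans stu.
rewrite (_ : _ - _ = (y ord0 i - w ord0 i) + (xi ord0 i - y ord0 i)); last by ring.
by rewrite (le_trans (ler_normD _ _))// lerD.
Qed.

Lemma near_ptW p (w xi : 'rV[R]_p) s t : s <= t ->
  near_pt w xi s -> near_pt w xi t.
Proof. by move=> st h i; exact: le_trans (h i) st. Qed.

(** The moduli 1 + i D with 1 <= i <= p, where p! q divides D, are pairwise coprime
    and coprime to q, as [sharp_point] requires, and yet all of the size of D.
    The grid they define in the hyperplane has about (tau D)^p points near w, at
    mutual distances of order 1 / D; this number exceeds D^(p - e) by a factor of
    order D^e. *)
Lemma grid (p : nat) (w : 'rV[R]_p.+1) (q : nat) (tau e : R) :
  (0 < p)%N -> (0 < q)%N -> q%:R * w ord0 ord0 \is a Num.int -> 0 < tau ->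
  0 < e < 1 ->
  exists (I : finType) (y : I -> 'rV[R]_p.+1) (b : nat -> nat) (r : R),
  [/\ 0 < r <= e, e^-1 <= #|I|%:R * (2 * r) `^ (p%:R - e),
    forall j, near_pt w (y j) tau /\ y j ord0 ord0 = w ord0 ord0,
    forall j k, j != k -> exists i : 'I_p,
      6 * r <= `|y j ord0 (lift ord0 i) - y k ord0 (lift ord0 i)| &
    [/\ forall i, (i <= p)%N -> (0 < b i)%N,
        forall i j, (i < j <= p)%N -> coprime (b i) (b j) &
        forall k (i : 'I_p.+1), (b i)%:R * y k ord0 i \is a Num.int]].
Proof.
move=> p0 q0 wq tau0 /andP[e0 e1].
pose kappa := tau / (12 * p%:R).
have pR : 0 < p%:R :> R by rewrite ltr0n.
have kappa0 : 0 < kappa by rewrite divr_gt0// mulr_gt0.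
(* These give, in this order, two grid steps in a box of side tau, the lower
   bound on the number of points, and r <= e. *)
pose D0 := Num.max (2 / tau) (Num.max ((1 / (e * kappa ^+ p)) `^ e^-1) e^-1).
pose t := (Num.truncn D0).+1.
pose D := (t * (p`! * q))%N.
have tD : D0 <= D%:R.
  apply/ltW/(lt_le_trans (truncnS_gt _)); rewrite ler_nat leq_pmulr//.
  by rewrite muln_gt0 fact_gt0.
have D1 : 2 / tau <= D%:R by rewrite (le_trans _ tD)// le_max lexx.
have D2 : (1 / (e * kappa ^+ p)) `^ e^-1 <= D%:R.
  by rewrite (le_trans _ tD)// !le_max lexx orbT.
have D3 : e^-1 <= D%:R by rewrite (le_trans _ tD)// !le_max lexx !orbT.
have D_gt0 : (0 < D)%N by rewrite muln_gt0/= muln_gt0 fact_gt0.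
have qD : (q %| D)%N by rewrite /D mulnA dvdn_mull.
have pD : (p`! %| D)%N by rewrite /D mulnCA dvdn_mulr.
clearbody D; have DR : 0 < D%:R :> R by rewrite ltr0n.
have DR1 : 1 <= D%:R :> R by rewrite ler1n.
pose J := Num.truncn (tau * D%:R).
have tD2 : 2 <= tau * D%:R by rewrite mulrC -ler_pdivrMr.
have JD : J%:R <= tau * D%:R by rewrite truncn_le; lra.
have DJ : tau * D%:R / 2 <= J%:R.
  have := truncnS_gt (tau * D%:R); rewrite -/J -natr1 => h; lra.
pose al (i : nat) := (1 + i * D)%N.
have al0 i : 0 < (al i)%:R :> R by rewrite ltr0n.
pose bt (i : 'I_p) := Num.ceil (w ord0 (lift ord0 i) * (al i.+1)%:R).
pose y (j : {ffun 'I_p -> 'I_J}) : 'rV[R]_p.+1 := \row_i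
  (if unlift ord0 i is Some k then ((bt k)%:~R + (j k)%:R) / (al k.+1)%:R
   else w ord0 ord0).
have y0 j : y j ord0 ord0 = w ord0 ord0 by rewrite mxE unlift_none.
have yl j k : y j ord0 (lift ord0 k) = ((bt k)%:~R + (j k)%:R) / (al k.+1)%:R.
  by rewrite mxE liftK.
pose r : R := (12 * p%:R * D%:R)^-1.
have r0 : 0 < r by rewrite invr_gt0 !mulr_gt0.
exists {ffun 'I_p -> 'I_J}, y, (fun k => if k == 0%N then q else al k), r; split.
- rewrite r0/= -[leRHS]invrK lef_pV2 ?posrE ?invr_gt0 ?mulr_gt0//.
  apply: (le_trans D3); rewrite ler_peMl//.
  have : 1 <= p%:R :> R by rewrite ler1n.
  lra.
- have r20 : 0 < 2 * r by rewrite mulr_gt0.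
  rewrite card_ffun !card_ord natrX powRD; last by rewrite (gt_eqF r20) implybT.
  rewrite powR_mulrn ?(ltW r20)// mulrA -exprMn powRN.
  have k1 : kappa <= J%:R * (2 * r).
    rewrite -ler_pdivrMr//; apply: le_trans DJ.
    rewrite /kappa /r le_eqVlt; apply/orP; left; apply/eqP; field.
    by rewrite !gt_eqF.
  apply: (@le_trans _ _ (kappa ^+ p / (2 * r) `^ e)); last first.
    apply: ler_wpM2r; first by rewrite invr_ge0 powR_ge0.
    by rewrite lerXn2r// nnegrE ?(ltW kappa0)// (le_trans _ k1)// ltW.
  apply: (@le_trans _ _ (kappa ^+ p * D%:R `^ e)).
    have k2 : 1 / (e * kappa ^+ p) <= D%:R `^ e.
      have : ((1 / (e * kappa ^+ p)) `^ e^-1) `^ e <= D%:R `^ e.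
        by rewrite ge0_ler_powR ?nnegrE ?powR_ge0// ltW.
      rewrite -powRrM mulVf ?gt_eqF// powRr1// divr_ge0// mulr_ge0//.
        exact: ltW.
      by rewrite exprn_ge0 ?(ltW kappa0).
    rewrite mulrC -ler_pdivrMr ?exprn_gt0//.
    by move: k2; rewrite div1r invfM.
  apply: ler_wpM2l; first by rewrite exprn_ge0// ltW.
  rewrite -[leRHS]div1r ler_pdivlMr ?powR_gt0// -powRM// ?(ltW r20)//.
  apply: (@le_trans _ _ (1 `^ e)); last by rewrite powR1.
  apply: ge0_ler_powR; first exact: ltW.
  - by rewrite nnegrE mulr_ge0 ?(ltW r20).
  - by rewrite nnegrE.
  have -> : D%:R * (2 * r) = (6 * p%:R)^-1.
    by rewrite /r; field; rewrite !gt_eqF.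
  rewrite invf_le1 ?mulr_gt0//.
  have : 1 <= p%:R :> R by rewrite ler1n.
  lra.
- move=> j; split => // i; case: (unliftP ord0 i) => [k ->|->]; last first.
    by rewrite y0 subrr normr0 ltW.
  rewrite yl.
  have al_gt0 := al0 k.+1; set A := (al k.+1)%:R in al_gt0 *.
  have -> : ((bt k)%:~R + (j k)%:R) / A - w ord0 (lift ord0 k) =
     (((bt k)%:~R - w ord0 (lift ord0 k) * A) + (j k)%:R) / A.
    by field; rewrite gt_eqF.
  have b1 : 0 <= (bt k)%:~R - w ord0 (lift ord0 k) * A.
    by rewrite subr_ge0 ceil_ge.
  have b2 : (bt k)%:~R - w ord0 (lift ord0 k) * A <= 1.
    rewrite lerBlDr addrC; have := ceilB1_lt (w ord0 (lift ord0 k) * A).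
    by rewrite -/(bt k) rmorphB/= ltrBlDr => /ltW.
  have jJ : (j k)%:R + 1 <= J%:R :> R by rewrite natr1 ler_nat.
  rewrite ger0_norm; last by apply: divr_ge0; [exact: addr_ge0 | exact: ltW].
  rewrite ler_pdivrMr//; apply: (@le_trans _ _ J%:R).
    by rewrite (le_trans _ jJ)// addrC lerD2l.
  apply: (le_trans JD); rewrite ler_pM2l// ler_nat /al.
  by rewrite (leq_trans _ (leq_addl _ _))// leq_pmull.
- move=> j k jk.
  have [i ijk] : exists i, j i != k i.
    apply/existsP; rewrite -negb_forall; apply: contra jk => /forallP h.
    by apply/eqP/ffunP => i; apply/eqP.
  exists i; rewrite !yl -mulrBl opprD addrACA subrr add0r normrM.
  rewrite [X in _ <= _ * X]ger0_norm ?invr_ge0//.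
  have n1 : 1 <= `|(j i)%:R - (k i)%:R| :> R.
    rewrite -(intrB _ (j i : int) (k i : int)) -intr_norm ler1z -gtz0_ge1 normr_gt0.
    by rewrite subr_eq0 eqz_nat.
  apply: (@le_trans _ _ (1 * (al i.+1)%:R^-1)); last first.
    by rewrite ler_wpM2r// invr_ge0.
  rewrite mul1r -[leLHS]invrK lef_pV2 ?posrE ?invr_gt0 ?mulr_gt0//.
  have -> : (6 * r)^-1 = (2 * p * D)%N%:R.
    by rewrite /r !natrM; field; rewrite !gt_eqF.
  rewrite ler_nat /al; apply: (@leq_trans (p * D + p * D)).
    apply: leq_add; first by rewrite muln_gt0 p0.
    by rewrite leq_mul2r ltn_ord orbT.
  by rewrite addnn -mul2n mulnA.
- split.
  + by move=> [|i].
  + move=> i l /andP[il lp].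
    case: i l il lp => [|i] [|l]// il lp; last first.
      by rewrite /= /al (coprime_progression D p)// il.
    rewrite /= /al; apply: coprime_dvdl qD _.
    by rewrite coprime_sym /coprime gcdnC addnC gcdnMDl gcdn1.
  + move=> k i; case: (unliftP ord0 i) => [l ->|->]; last by rewrite y0.
    apply/intrP; exists (bt l + (k l)%:Z); rewrite yl /= /bump/= rmorphD/=.
    by rewrite mulrC divfK// gt_eqF.
Qed.
End Grid.

Section StageLemma.
Variable R : realType.

(** One level of the construction.  From q to q' j there are three ranges.  Up
    to Q0, the point w itself approximates xi well, because xi lies in a box
    around w chosen after Q0; this also bounds q^N psi(q).  From Q0 to the denominator of a
    grid point y j, the hyperplane estimate at y j applies.  Beyond it
    [sharp_point] applies.  The grid points share their first coordinate, hence
    the domination of the first coordinate in the separation of children. *)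
Lemma stage (p : nat) (c e : R) (w : 'rV[R]_p.+1) (q : nat) (tau : R) (N : nat) :
  (0 < p)%N -> 0 < c <= 1 -> 0 < e < 1 -> (0 < q)%N ->
  (forall i, q%:R * w ord0 i \is a Num.int) -> 0 < tau ->
  exists (I : finType) (w' : I -> 'rV[R]_p.+1) (q' : I -> nat) (tau' : I -> R)
    (r : R),
  [/\ 0 < r <= e, e^-1 <= #|I|%:R * (2 * r) `^ (p%:R - e),
    forall j, [/\ (q < q' j)%N, forall i, (q' j)%:R * w' j ord0 i \is a Num.int,
       0 < tau' j <= e &
       forall xi, near_pt (w' j) xi (tau' j) -> near_pt w xi tau],
    forall j k, j != k -> forall xi eta : 'rV[R]_p.+1,
      near_pt (w' j) xi (tau' j) -> near_pt (w' k) eta (tau' k) ->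
      exists i : 'I_p,
        `|xi ord0 ord0 - eta ord0 ord0|
           <= `|xi ord0 (lift ord0 i) - eta ord0 (lift ord0 i)| /\
        4 * r <= `|xi ord0 (lift ord0 i) - eta ord0 (lift ord0 i)| &
    forall j xi, near_pt (w' j) xi (tau' j) ->
      [/\ forall T, q%:R <= T -> T <= (q' j)%:R ->
            T `^ (p.+1%:R^-1) * psi xi T <= c + e,
          exists2 T, q%:R <= T & c - e <= T `^ (p.+1%:R^-1) * psi xi T &
          q%:R ^+ N * psi xi q%:R <= e]].
Proof.
move=> p0 c01 /andP[e0 e1] q0 wq tau0.
have c0 : 0 < c by case/andP: c01.
have e20 : 0 < e / 2 by rewrite divr_gt0.
have [Q0 Q01 Q0P] := hyperplane_dirichlet R p q (e / 2) p0 q0 e20.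
have q1 : 1 <= q%:R :> R by rewrite ler1n.
have qR : 0 < q%:R :> R by rewrite ltr0n.
have Q00 : 0 < Q0 by apply: lt_le_trans Q01.
(* All xi considered are within 2 t1 of w; the two quotients take care of psi up
   to Q0 and of psi at q. *)
pose t1 := Num.min tau (Num.min (e / (Q0 * q%:R)) (e / q%:R ^+ N.+1)) / 2.
have qN : 0 < q%:R ^+ N.+1 :> R by rewrite exprn_gt0.
have t10 : 0 < t1.
  by rewrite divr_gt0// !lt_min tau0/= !divr_gt0// mulr_gt0.
have t2E : t1 + t1 = Num.min tau (Num.min (e / (Q0 * q%:R)) (e / q%:R ^+ N.+1)).
  by rewrite /t1; lra.
have t1tau : t1 + t1 <= tau by rewrite t2E ge_min lexx.
have t1a : Q0 * (q%:R * (t1 + t1)) <= e.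
  by rewrite mulrA mulrC -ler_pdivlMr ?mulr_gt0// t2E !ge_min lexx orbT.
have t1b : q%:R ^+ N * (q%:R * (t1 + t1)) <= e.
  by rewrite mulrA -exprSr mulrC -ler_pdivlMr// t2E !ge_min lexx !orbT.
have e01 : 0 < e < 1 by rewrite e0.
have [I [y [b [r [/andP[r0 re] cnt ynear ysep [b0 bco bint]]]]]] :=
  grid R p w q t1 e p0 q0 (wq ord0) t10 e01.
have sp j := sharp_point R p (y j) b c e p0 b0 bco (bint j) c01 e0.
(* Distance from y j allowed for its child: r keeps siblings apart, t1 keeps
   the child inside its parent, and the last term serves between Q0 and qy. *)
pose sg (qy : nat) := Num.min r (Num.min t1 (e / 2 / qy%:R ^+ 2)).
have main j : exists wqt : 'rV[R]_p.+1 * nat * R,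
  let: (z, Q, t) := wqt in
  [/\ (q < Q)%N, forall i, Q%:R * z ord0 i \is a Num.int, 0 < t <= e,
    forall xi, near_pt z xi t ->
      near_pt (y j) xi r /\ near_pt (y j) xi t1 &
    forall xi, near_pt z xi t ->
     (forall T, Q0 <= T -> T <= Q%:R -> T `^ (p.+1%:R^-1) * psi xi T <= c + e) /\
     (exists2 T, q%:R <= T & c - e <= T `^ (p.+1%:R^-1) * psi xi T)].
  have [qy qy0 qyP] := sp j.
  have qyR : 0 < qy%:R :> R by rewrite ltr0n.
  have qy1 : 1 <= qy%:R :> R by rewrite ler1n.
  have sg0 : 0 < sg qy.
    by rewrite !lt_min r0 t10/= divr_gt0// exprn_gt0.
  have sgr : sg qy <= r by rewrite ge_min lexx.
  have sgt : sg qy <= t1 by rewrite !ge_min lexx orbT.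
  have sgq : qy%:R * (qy%:R * sg qy) <= e / 2.
    rewrite mulrA -expr2 mulrC -ler_pdivlMr ?exprn_gt0//.
    by rewrite !ge_min lexx !orbT.
  have [Q [z [d [d0 BQ zint zy zP]]]] := qyP (Num.max (q%:R + 1) (2 / sg qy)).
  have B1 : q%:R + 1 <= Num.max (q%:R + 1) (2 / sg qy) by rewrite le_max lexx.
  have B2 : 2 / sg qy <= Num.max (q%:R + 1) (2 / sg qy) by rewrite le_max lexx orbT.
  have zn : near_pt (y j) z (sg qy / 2).
    move=> i; have : 2 / sg qy * `|z ord0 i - y j ord0 i| <= 1.
      by apply: le_trans (zy i); rewrite ler_wpM2r.
    by rewrite mulrAC ler_pdivrMr// mul1r ler_pdivlMr// mulrC.
  exists (z, Q, Num.min d (sg qy / 2)); split => //.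
  - by rewrite -(ltr_nat R) (lt_le_trans _ BQ)// (lt_le_trans _ B1)// ltrDl.
  - rewrite lt_min d0 divr_gt0//= ge_min; apply/orP; right.
    apply: (le_trans _ re); apply: (le_trans _ sgr).
    by rewrite ler_pdivrMr// ler_peMr ?ler1n// ltW.
  - move=> xi xiz.
    have xin : near_pt (y j) xi (sg qy).
      have xiz' : near_pt z xi (sg qy / 2).
        by apply: near_ptW xiz; rewrite ge_min lexx orbT.
      by apply: near_ptD zn xiz'; rewrite -splitr.
    by split; apply: near_ptW xin.
  - move=> xi xiz.
    have xin : near_pt (y j) xi (sg qy).
      have xiz' : near_pt z xi (sg qy / 2).
        by apply: near_ptW xiz; rewrite ge_min lexx orbT.
      by apply: near_ptD zn xiz'; rewrite -splitr.
    have [|up [S SB SP]] := zP xi.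
      by apply: near_ptW xiz; rewrite ge_min lexx.
    split; last by exists S => //; rewrite (le_trans _ SB)// (le_trans _ B1)// lerDl.
    move=> T Q0T TQ; have [qT|/ltW Tq] := leP (qy%:R) T; first exact: up.
    have T1 : 1 <= T by apply: le_trans Q0T.
    have T0 : 0 <= T by apply: le_trans T1.
    have [|k [v [k0 kT v0 Tv] vP]] := Q0P (y j) T _ Q0T.
      by rewrite (ynear j).2; exact: wq.
    have ps : psi xi T <= v + k%:R * sg qy.
      by apply: (psi_perturb R _ _ (y j)) => //; exact: ltW.
    have := ler_wpM2l (powR_ge0 T (p.+1%:R^-1)) ps; move=> /le_trans; apply.
    rewrite mulrDr; apply: (@le_trans _ _ (e / 2 + e / 2)).
      apply: lerD => //; apply: (le_trans _ sgq).
      apply: ler_pM; [exact: powR_ge0|by rewrite mulr_ge0// ltW| |].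
        by apply: le_trans Tq; apply: mroot_le.
      by rewrite ler_pM2r// (le_trans kT).
    by rewrite -splitr lerDr ltW.
have [wqt wqtP] := choice main.
exists I, (fun j => (wqt j).1.1), (fun j => (wqt j).1.2), (fun j => (wqt j).2), r.
split => //.
- by rewrite r0 re.
- move=> j; have := wqtP j; case: (wqt j) => [[z Q] t] /= [h1 h2 h3 h4 h5].
  split => // xi /h4[_ h]; apply: near_ptD (ynear j).1 h.
  exact: t1tau.
- move=> j k jk xi eta.
  have := wqtP j; case: (wqt j) => [[z Q] t] /= [_ _ _ h4 _] /h4[xij _] {h4}.
  have := wqtP k; case: (wqt k) => [[z' Q'] t'] /= [_ _ _ h4 _] /h4[etak _].
  have [i iP] := ysep j k jk; exists i.
  have h1 : 4 * r <= `|xi ord0 (lift ord0 i) - eta ord0 (lift ord0 i)|.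
    have a1 := xij (lift ord0 i); have a2 := etak (lift ord0 i).
    move: a1 a2 iP; rewrite !ler_norml.
    move: (xi _ _) (eta _ _) (y j _ _) (y k _ _) => X1 X2 X3 X4.
    clear -r0 => /andP[? ?] /andP[? ?].
    by case: (ger0P (X3 - X4)) => ? ?; case: (ger0P (X1 - X2)) => ?; lra.
  split => //; apply: le_trans h1.
  have := xij ord0; have := etak ord0; rewrite (ynear j).2 (ynear k).2 !ler_norml.
  move: (xi _ _) (eta _ _) (w _ _) => X1 X2 X3.
  clear -r0 => /andP[? ?] /andP[? ?]; apply/andP; split; lra.
- move=> j xi; have := wqtP j; case: (wqt j) => [[z Q] t] /= [qQ _ _ h4 h5] xiz.
  have [up lo] := h5 _ xiz.
  have xiw : near_pt w xi (t1 + t1).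
    by apply: near_ptD (ynear j).1 (h4 _ xiz).2.
  have ps T : q%:R <= T -> psi xi T <= q%:R * (t1 + t1).
    move=> qT; rewrite -[leRHS]add0r.
    apply: (psi_perturb R _ _ w) => //; first by rewrite addr_ge0// ltW.
    move=> i; have /intrP[P PE] := wq i; exists P.
    by rewrite PE subrr normr0.
  split => //.
    move=> T qT TQ; have [Q0T|/ltW TQ0] := leP Q0 T; first exact: up.
    have T1 : 1 <= T by apply: le_trans qT.
    apply: (@le_trans _ _ (Q0 * (q%:R * (t1 + t1)))).
      apply: ler_pM; [exact: powR_ge0|exact: psi_ge0| |exact: ps].
      by apply: le_trans TQ0; apply: mroot_le.
    by rewrite (le_trans t1a)// lerDr ltW.
  apply: le_trans t1b; rewrite ler_pM2l ?exprn_gt0//; exact: ps.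
Qed.
End StageLemma.

(** * A volume bound for packings *)

Section PackingVolume.
Variable R : realType.

(** Count points of the grid of step 1 / M in the cubes of centre x k and radius
    r k / 2.  The cubes are disjoint, each contains at least (r k M / 2)^p grid
    points, and altogether there are at most (2 M (L + 2))^p. *)
Lemma packing_volume (p N : nat) (x : 'I_N -> 'I_p -> R) (r : 'I_N -> R) (L : R) :
  (0 < p)%N -> 0 <= L -> (forall k, 0 < r k <= 1) ->
  (forall k i, 0 <= x k i <= L) ->
  (forall k l, k != l -> exists i, (r k + r l) / 2 <= `|x k i - x l i|) ->
  \sum_k r k ^+ p <= (4 * (L + 2)) ^+ p.
Proof.
move=> p0 L0 r01 x0L sep.
case: N x r r01 x0L sep => [|N] x r r01 x0L sep.
  by rewrite big_ord0 exprn_ge0// mulr_ge0// addr_ge0.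
pose M := (\sum_k (Num.truncn (2 / r k)).+1)%N.
have rM k : 2 <= r k * M%:R.
  have /andP[rk _] := r01 k; rewrite mulrC -ler_pdivrMr//.
  apply/ltW/(lt_le_trans (truncnS_gt _)); rewrite ler_nat /M (bigD1 k)//=.
  exact: leq_addr.
have M1 : 1 <= M%:R :> R.
  have := rM ord0; have /andP[rk rk1] := r01 ord0 => h.
  have : r ord0 * M%:R <= 1 * M%:R by rewrite ler_wpM2r.
  lra.
have M0 : 0 < M%:R :> R by lra.
(* The translation by 1 makes the grid coordinates natural numbers. *)
pose lo k i := M%:R * (x k i + 1 - r k / 2).
have lo0 k i : 0 <= lo k i.
  rewrite mulr_ge0//.
  have /andP[? ?] := r01 k; have /andP[? ?] := x0L k i; lra.
pose a k i := (Num.truncn (lo k i)).+1.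
have a1 k i : lo k i < (a k i)%:R by apply: truncnS_gt.
have a2 k i : (a k i)%:R <= lo k i + 1.
  by rewrite -natr1 lerD2r truncn_le.
pose n k := Num.truncn (r k * M%:R).
have nM k : (n k)%:R <= r k * M%:R by rewrite truncn_le; have := rM k; lra.
have Mn k : r k * M%:R / 2 <= (n k)%:R.
  have := truncnS_gt (r k * M%:R); rewrite -/(n k) -natr1; have := rM k; lra.
pose K := (Num.truncn (M%:R * (L + 2))).+1.
have KL : (M%:R * (L + 2)) < K%:R by apply: truncnS_gt.
have LK : K%:R <= 2 * (M%:R * (L + 2)).
  rewrite /K -natr1.
  have h : 1 <= M%:R * (L + 2) by rewrite mulr_ege1//; lra.
  have : (Num.truncn (M%:R * (L + 2)))%:R <= M%:R * (L + 2) by rewrite truncn_le; lra.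
  lra.
pose win k (z : {ffun 'I_p -> 'I_K}) :=
  [forall i, (lo k i < (z i)%:R) && ((z i)%:R <= lo k i + r k * M%:R)].
have winsep k l z : win k z -> win l z -> k = l.
  move=> /forallP hk /forallP hl; apply: contrapT => /eqP kl.
  have [i] := sep k l kl; apply/negP; rewrite -ltNge.
  have /andP[k1 k2] := hk i; have /andP[l1 l2] := hl i.
  rewrite -(ltr_pM2l M0) -{1}[M%:R]ger0_norm ?ltW// -normrM ltr_norml.
  move: k1 k2 l1 l2; rewrite /lo => k1 k2 l1 l2.
  by apply/andP; split; lra.
have wincard k : (n k ^ p <= #|[pred z | win k z]|)%N.
  pose F (u : {ffun 'I_p -> 'I_(n k)}) : {ffun 'I_p -> 'I_K} :=
    [ffun i => inord (a k i + u i)].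
  have Fval u i : (F u i : nat) = (a k i + u i)%N.
    rewrite ffunE inordK// -(ltr_nat R) (le_lt_trans _ KL)//.
    have u1 : (u i)%:R + 1 <= (n k)%:R :> R by rewrite natr1 ler_nat.
    have := a2 k i; have := nM k; rewrite natrD /lo.
    have /andP[x1 x2] := x0L k i; have /andP[r1 r2] := r01 k => h1 h2.
    have : M%:R * (x k i + 1 + r k / 2) <= M%:R * (L + 2).
      by rewrite ler_pM2l//; lra.
    lra.
  have Finj : injective F.
    move=> u v uv; apply/ffunP => i; apply: val_inj => /=.
    by apply/eqP; rewrite -(eqn_add2l (a k i)) -!Fval uv.
  have -> : (n k ^ p = #|[set F u | u in [set: {ffun 'I_p -> 'I_(n k)}]]%SET|)%N.
    by rewrite card_imset// cardsT card_ffun !card_ord.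
  apply: subset_leq_card; apply/fintype.subsetP => z /imsetP[u _ ->].
  rewrite inE; apply/forallP => i; rewrite Fval natrD.
  have u1 : (u i)%:R + 1 <= (n k)%:R :> R by rewrite natr1 ler_nat.
  have u0 : 0 <= (u i)%:R :> R by [].
  have := a1 k i; have := a2 k i; have := nM k => h1 h2 h3.
  by apply/andP; split; lra.
have tot : (\sum_k n k ^ p <= K ^ p)%N.
  apply: (@leq_trans (\sum_k #|[pred z | win k z]|)%N); first exact: leq_sum.
  have -> : (\sum_k #|[pred z | win k z]| =
      \sum_(z : {ffun 'I_p -> 'I_K}) \sum_k (win k z : nat))%N.
    rewrite exchange_big/=; apply: eq_bigr => k _.
    by rewrite -sum1_card big_mkcond.
  have -> : (K ^ p = \sum_(z : {ffun 'I_p -> 'I_K}) 1)%N.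
    by rewrite sum1_card card_ffun !card_ord.
  apply: leq_sum => z _.
  have [/existsP[k kz]|] := boolP [exists k, win k z]; last first.
    by rewrite negb_exists => /forallP h; rewrite big1// => k _; rewrite (negbTE (h k)).
  rewrite (bigD1 k)//= big1 ?addn0 ?leq_b1// => l lk.
  by apply/eqP; rewrite eqb0; apply: contra lk => lz; apply/eqP; exact: (winsep _ _ z).
have totR : \sum_k (r k * M%:R / 2) ^+ p <= (2 * (M%:R * (L + 2))) ^+ p.
  apply: (@le_trans _ _ (\sum_k (n k)%:R ^+ p)).
    apply: ler_sum => k _; rewrite lerXn2r ?nnegrE//.
    have /andP[? ?] := r01 k; rewrite !mulr_ge0// ltW//.
  apply: (@le_trans _ _ (K%:R ^+ p)).
    by under eq_bigr do rewrite -natrX; rewrite -natr_sum -natrX ler_nat.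
  by rewrite lerXn2r ?nnegrE// !mulr_ge0//; lra.
have M2 : 0 < (M%:R / 2 : R) ^+ p by rewrite exprn_gt0// divr_gt0.
rewrite -(ler_pM2r M2) mulr_suml -exprMn.
under eq_bigr do rewrite -exprMn mulrA.
apply: le_trans totR _; rewrite le_eqVlt; apply/orP; left; apply/eqP.
by congr (_ ^+ p); field.
Qed.
End PackingVolume.

(** * Cantor schemes and their limit sets *)

Definition tol (R : realType) (k : nat) : R := k.+2%:R^-1.

Lemma tol_bounds (R : realType) k : 0 < tol R k < 1.
Proof. by rewrite invr_gt0 ltr0n/= invf_lt1 ?ltr1n. Qed.

Lemma tol_le_half (R : realType) k : tol R k <= 2^-1.
Proof. by rewrite lef_pV2 ?posrE// ler_nat. Qed.

Lemma tol_lt (R : realType) (d : R) : 0 < d ->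
  exists k0, forall k, (k0 <= k)%N -> tol R k < d.
Proof.
move=> d0; exists (Num.truncn d^-1) => k k0.
rewrite -[d]invrK ltf_pV2 ?posrE ?invr_gt0//.
by apply: (lt_le_trans (truncnS_gt _)); rewrite ler_nat ltnS leqW.
Qed.

(** A tree of boxes in R^(p+1).  By [kids_many] and [kid_sep] the number of
    children of a node is almost the p-th power of 1 / gap, which yields the lower
    bound on the dimension.  The first inequality of [kid_sep] makes the limit
    set a graph over the last p coordinates, which yields the upper bound.  The
    factor 4 leaves room for disjoint closed balls of radius gap. *)
Record cantor_scheme (R : realType) (p : nat) := CantorScheme {
  node : Type;
  root : node;
  kids : node -> finType;
  kid : forall s, kids s -> node;
  ctr : node -> 'rV[R]_p.+1;
  rad : node -> R;
  gap : node -> R;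
  lev : node -> nat;
  lev_kid : forall s (j : kids s), lev (kid s j) = (lev s).+1;
  rad_gt0 : forall s, 0 < rad s;
  rad_kid : forall s (j : kids s), rad (kid s j) <= tol R (lev s);
  gap_gt0 : forall s, 0 < gap s;
  gap_le : forall s, gap s <= tol R (lev s);
  kids_many : forall s,
    (tol R (lev s))^-1 <= #|kids s|%:R * (2 * gap s) `^ (p%:R - tol R (lev s));
  kid_sub : forall s (j : kids s) xi,
    near_pt (ctr (kid s j)) xi (rad (kid s j)) -> near_pt (ctr s) xi (rad s);
  kid_sep : forall s (j k : kids s), j != k -> forall xi eta,
    near_pt (ctr (kid s j)) xi (rad (kid s j)) ->
    near_pt (ctr (kid s k)) eta (rad (kid s k)) ->
    exists i : 'I_p,
      `|xi ord0 ord0 - eta ord0 ord0| <=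
        `|xi ord0 (lift ord0 i) - eta ord0 (lift ord0 i)| /\
      4 * gap s <= `|xi ord0 (lift ord0 i) - eta ord0 (lift ord0 i)|
}.

Arguments node {R p} c.
Arguments root {R p} c.
Arguments kids {R p} c s.
Arguments kid {R p} c s j.
Arguments ctr {R p} c s.
Arguments rad {R p} c s.
Arguments gap {R p} c s.
Arguments lev {R p} c s.
Arguments lev_kid {R p} c s j.
Arguments rad_gt0 {R p} c s.
Arguments rad_kid {R p} c s j.
Arguments gap_gt0 {R p} c s.
Arguments gap_le {R p} c s.
Arguments kids_many {R p} c s.
Arguments kid_sub {R p} c {s j xi} _.
Arguments kid_sep {R p} c s j k _ xi eta _ _.

Local Notation "x \isin s" := (near_pt (ctr _ s) x (rad _ s)) (at level 70).

Section Tree.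
Variables (R : realType) (p : nat).
Implicit Types (xi eta : 'rV[R]_p.+1).

Variable T : cantor_scheme R p.

Definition limit_set : set 'rV[R]_p.+1 :=
  [set xi | exists g : nat -> node T, g 0%N = root T /\
     forall n, (exists j, g n.+1 = kid T (g n) j) /\ xi \isin g n].

Inductive below : node T -> node T -> Prop :=
| below_refl s : below s s
| below_step s j t : below (kid T s j) t -> below s t.

Lemma below_sub s t xi : below s t -> xi \isin t -> xi \isin s.
Proof. by elim=> // {}s j {}t _ IH /IH; exact: kid_sub. Qed.

Lemma below_trans s t u : below s t -> below t u -> below s u.
Proof. by elim=> // {}s j {}t _ IH /IH; exact: below_step. Qed.

Lemma below_kidP s t : below s t -> s = t \/ exists j, below (kid T s j) t.
Proof. by case=> [{}s|{}s j {}t b]; [left|right; exists j]. Qed.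

Lemma kids_gt0 s : (0 < #|kids T s|)%N.
Proof.
rewrite lt0n; apply/eqP => c0; have := kids_many T s; rewrite c0 mul0r.
by apply/negP; rewrite -ltNge invr_gt0; case/andP: (tol_bounds R (lev T s)).
Qed.

Lemma some_kid s : exists j : kids T s, True.
Proof. by have /card_gt0P[j _] := kids_gt0 s; exists j. Qed.

Lemma below_level s k : exists2 t, below s t & (k <= lev T t)%N.
Proof.
elim: k => [|k [t st kt]]; first by exists s => //; exact: below_refl.
have [j _] := some_kid t.
exists (kid T t j); last by rewrite lev_kid ltnS.
by apply: below_trans st _; apply: below_step (below_refl _).
Qed.

Lemma nested_point (g : nat -> node T) :
  (forall n xi, xi \isin g n.+1 -> xi \isin g n) ->
  exists xi, forall n, xi \isin g n.
Proof.
move=> nest.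
pose lo i n := ctr T (g n) ord0 i - rad T (g n).
pose hi i n := ctr T (g n) ord0 i + rad T (g n).
have r0 n : 0 < rad T (g n) by exact: rad_gt0.
have lohi i n : lo i n <= lo i n.+1 /\ hi i n.+1 <= hi i n.
  have h1 : (ctr T (g n.+1) + const_mx (rad T (g n.+1))) \isin g n.+1.
    by move=> k; rewrite !mxE addrAC subrr add0r ger0_norm// ltW.
  have h2 : (ctr T (g n.+1) - const_mx (rad T (g n.+1))) \isin g n.+1.
    by move=> k; rewrite !mxE addrAC subrr add0r normrN ger0_norm// ltW.
  have := nest _ _ h1 i; have := nest _ _ h2 i; rewrite !mxE !ler_norml /lo /hi.
  by move=> /andP[? ?] /andP[? ?]; split; lra.
have lomono i n m : (n <= m)%N -> lo i n <= lo i m.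
  by move/subnK <-; elim: (m - n)%N => // k IH; apply: (le_trans IH); exact: (lohi _ _).1.
have himono i n m : (n <= m)%N -> hi i m <= hi i n.
  by move/subnK <-; elim: (m - n)%N => // k; apply: le_trans; exact: (lohi _ _).2.
have lolehi i n m : lo i n <= hi i m.
  apply: (@le_trans _ _ (lo i (maxn n m))); first exact/lomono/leq_maxl.
  apply: (@le_trans _ _ (hi i (maxn n m))); last exact/himono/leq_maxr.
  by rewrite /lo /hi; have := r0 (maxn n m); lra.
exists (\row_i sup (range (lo i))) => n i; rewrite mxE.
have hs : has_sup (range (lo i)).
  by split; [exists (lo i 0%N), 0%N|exists (hi i 0%N) => _ [k _ <-]].
have h1 : lo i n <= sup (range (lo i)) by apply: sup_upper_bound => //; exists n.
have h2 : sup (range (lo i)) <= hi i n.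
  by apply: sup_le_ub => [|_ [k _ <-]//]; exact: hs.1.
by rewrite ler_norml; move: h1 h2; rewrite /lo /hi => *; apply/andP; split; lra.
Qed.

(** Dependent choice extracts a branch from P. *)
Lemma limit_setP (P : node T -> Prop) xi : P (root T) ->
  (forall s, P s -> exists j, P (kid T s j)) ->
  (forall s, P s -> xi \isin s) -> limit_set xi.
Proof.
move=> Proot Pkid Pin.
have step (x : {s | P s}) : {y : {s | P s} | exists j, sval y = kid T (sval x) j}.
  apply: cid; case: x => s Ps; have [j Pj] := Pkid s Ps.
  by exists (exist _ _ Pj), j.
have [g [g0 gS]] := dependent_choice step (exist _ _ Proot).
exists (fun n => sval (g n)); split; first by rewrite g0.
by move=> n; split; [exact: gS|apply: Pin; exact: svalP].
Qed.

(** The sequence g may skip levels; the nodes that have some g n below them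
    supply the missing ones. *)
Lemma limit_point (g : nat -> node T) : below (root T) (g 0%N) ->
  (forall n, exists j, below (kid T (g n) j) (g n.+1)) ->
  exists2 xi, limit_set xi & forall n, xi \isin g n.
Proof.
move=> groot gS.
have [|xi xig] := nested_point g.
  move=> n xi; have [j b] := gS n; apply: below_sub; exact: below_step b.
exists xi => //.
apply: (limit_setP (fun s => exists n, below s (g n))).
- by exists 0%N.
- move=> s [n /below_kidP[->|[j b]]]; last by exists j, n.
  by have [j b] := gS n; exists j, n.+1.
- by move=> s [n sn]; apply: below_sub sn _; exact: xig.
Qed.

End Tree.

Arguments limit_set {R p} T.
Arguments below {R p T} s t.

(** * The packing dimension of a limit set is at most p *)

Lemma packing_premeasure_ge0 (R : realType) (V : pseudoMetricType R) (s : R)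
  (A : set V) : (0 <= packing_premeasure s A)%E.
Proof.
apply: le_ereal_inf_tmp => _ [d d0 <-].
apply: ereal_sup_ubound; exists set0; last by rewrite /packing_size esum_set0.
by split=> // i j [].
Qed.

Section UpperBound.
Variables (R : realType) (p : nat) (T : cantor_scheme R p).
Hypothesis p0 : (0 < p)%N.

(** Two distinct branches separate at siblings, where [kid_sep] applies; equal
    branches have the same limit point. *)
Lemma limit_graph (xi eta : 'rV[R]_p.+1) :
  limit_set T xi -> limit_set T eta ->
  exists i : 'I_p, `|xi ord0 ord0 - eta ord0 ord0| <=
        `|xi ord0 (lift ord0 i) - eta ord0 (lift ord0 i)|.
Proof.
move=> [g [g0 gP]] [h [h0 hP]].
have [gh|/existsNP nex] := pselect (forall n, g n = h n).
  exists (Ordinal p0); suff -> : xi ord0 ord0 = eta ord0 ord0 by rewrite subrr normr0.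
  apply/eqP; rewrite -subr_eq0 -normr_le0; apply/ler_addgt0Pr => d d0.
  rewrite add0r.
  have levg n : lev T (g n.+1) = (lev T (g n)).+1.
    by have [[j ->] _] := gP n; rewrite lev_kid.
  have levn n : (n <= lev T (g n))%N.
    by elim: n => // n IH; rewrite levg.
  have [|k kP] := tol_lt R (d / 2); first by rewrite divr_gt0.
  have [_ x1] := gP k.+1; have [_ x2] := hP k.+1; rewrite -gh in x2.
  have rd : rad T (g k.+1) <= d / 2.
    have [[j ->] _] := gP k; apply: (le_trans (rad_kid _ _ _)).
    by apply/ltW/kP/levn.
  move: (x1 ord0) (x2 ord0); rewrite !ler_norml => /andP[? ?] /andP[? ?].
  by apply/andP; split; lra.
have [n gn hn] : exists2 n, g n = h n & g n.+1 <> h n.+1.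
  case: nex => n0 ne0; apply: contrapT => H; apply: ne0.
  elim: n0 => [|n IH]; first by rewrite g0 h0.
  by apply: contrapT => ne; apply: H; exists n.
have [[j gj] _] := gP n; have [[k hk] _] := hP n.
have [_ x1] := gP n.+1; have [_ x2] := hP n.+1.
move: k hk; rewrite -gn => k hk.
rewrite gj in x1; rewrite hk in x2.
have jk : j != k by apply/eqP => jk; apply: hn; rewrite gj hk jk.
by have [i [h1 h2]] := kid_sep T _ j k jk _ _ x1 x2; exists i.
Qed.

Lemma ball_row m (x y : 'rV[R]_m) (r : R) :
  ball x r y <-> 0 < r /\ forall i, `|x ord0 i - y ord0 i| < r.
Proof.
split=> [[r0 h]|[r0 h]]; first by split=> // i; exact: h.
by split=> // i j; rewrite (ord1 i); exact: h.
Qed.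

(** If the centres were closer than the larger radius in every coordinate, one
    centre would belong to both balls. *)
Lemma packing_far (A : set 'rV[R]_p.+1) (d : R) P (a b : 'rV[R]_p.+1 * R) :
  is_packing A d P -> P a -> P b -> a != b ->
  exists i, (a.2 + b.2) / 2 <= `|a.1 ord0 i - b.1 ord0 i|.
Proof.
move=> [hP tP]; wlog ab : a b / b.2 <= a.2 => [W Pa Pb ab|Pa Pb].
  have [ba|/ltW ba] := leP b.2 a.2; first exact: W.
  have [|i hi] := W b a ba Pb Pa; first by rewrite eq_sym.
  by exists i; rewrite distrC addrC.
apply: contra_neqP => H.
have [_ a0 _] := hP a Pa; have [_ b0 _] := hP b Pb.
apply: (tP a b Pa Pb); exists b.1; split; last exact: closed_ballxx.
apply: subset_closed_ball; apply/ball_row; split => // i.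
rewrite ltNge; apply/negP => h; apply: H; exists i.
by apply: le_trans h; lra.
Qed.

(** By [limit_graph], the centres remain as far apart after forgetting the first
    coordinate, so [packing_volume] bounds the sum of the p-th powers of the
    radii; the remaining power s - p is bounded through the largest radius. *)
Lemma packing_size_le (s : R) : p%:R < s -> exists2 C : R, 0 < C &
  forall d P, 0 < d <= 1 -> is_packing (limit_set T) d P ->
   (packing_size s P <= (C * (2 * d) `^ (s - p%:R))%:E)%E.
Proof.
move=> ps; pose L := 2 * rad T (root T).
have L0 : 0 <= L by rewrite mulr_ge0// ltW// rad_gt0.
exists (2 ^+ p * (4 * (L + 2)) ^+ p).
  by rewrite mulr_gt0 ?exprn_gt0// mulr_gt0// ltr_wpDl.
move=> d P /andP[d0 d1] packP; have [hP _] := packP.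
apply: ge_ereal_sup => _ [X [finX XP] <-].
rewrite fsbig_finite// sumEFin lee_fin.
have {}XP : forall a, a \in finmap.enum_fset (fset_set X) -> P a.
  move=> a aX; apply: XP; have h := in_fset_set finX a.
  by rewrite -inE -h; exact: aX.
have := finmap.fset_uniq (fset_set X).
move: (finmap.enum_fset (fset_set X)) XP => Y YP uY.
rewrite (big_nth (0, 0)) big_mkord.
pose y (k : 'I_(size Y)) := nth (0, 0) Y k.
have yP k : P (y k) by apply/YP/mem_nth.
have yr k : 0 < (y k).2 <= d by have [_ -> ->] := hP _ (yP k).
apply: (@le_trans _ _ (\sum_(k < size Y)
    (2 ^+ p * (2 * d) `^ (s - p%:R)) * (y k).2 ^+ p)).
  apply: ler_sum => k _; rewrite -/(y k); have /andP[r0 rd] := yr k.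
  have r20 : 0 < 2 * (y k).2 by rewrite mulr_gt0.
  have -> : s = (s - p%:R) + p%:R by rewrite subrK.
  rewrite powRD; last by rewrite (gt_eqF r20) implybT.
  rewrite powR_mulrn ?(ltW r20)// exprMn addrK [leRHS]mulrAC [leLHS]mulrC.
  apply: ler_wpM2l; first by rewrite mulr_ge0 ?exprn_ge0// ltW.
  apply: ge0_ler_powR; first by rewrite subr_ge0 ltW.
  - by rewrite nnegrE ltW.
  - by rewrite nnegrE mulr_ge0// ltW.
  - by rewrite ler_pM2l.
rewrite -mulr_sumr [leRHS]mulrAC ler_wpM2l//.
  by apply: mulr_ge0; [exact: exprn_ge0|exact: powR_ge0].
pose x (k : 'I_(size Y)) (i : 'I_p) := (y k).1 ord0 (lift ord0 i) -
  (ctr T (root T) ord0 (lift ord0 i) - rad T (root T)).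
apply: (@packing_volume _ _ _ x) => //.
- by move=> k; have /andP[-> h] := yr k; rewrite (le_trans h).
- move=> k i; have [[g [g0 gP]] _ _] := hP _ (yP k).
  have [_] := gP 0%N; rewrite g0 => /(_ (lift ord0 i)).
  rewrite ler_norml /x /L => /andP[? ?]; apply/andP; split; lra.
- move=> k l kl.
  have ykl : y k != y l by rewrite /y nth_uniq.
  have [j hj] := packing_far _ _ _ _ _ packP (yP k) (yP l) ykl.
  have xE i : x k i - x l i = (y k).1 ord0 (lift ord0 i) - (y l).1 ord0 (lift ord0 i).
    by rewrite /x; lra.
  case: (unliftP ord0 j) => [i ji|j0]; first by exists i; rewrite xE -ji.
  have [Ak _ _] := hP _ (yP k); have [Al _ _] := hP _ (yP l).
  have [i hi] := limit_graph _ _ Ak Al; exists i; rewrite xE.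
  by apply: le_trans hi; rewrite -j0.
Qed.

Lemma packing_measure_limit0 (s : R) : p%:R < s ->
  packing_measure s (limit_set T) = 0%E.
Proof.
move=> ps; have [C C0 CP] := packing_size_le s ps.
have pre0 : packing_premeasure s (limit_set T) = 0%E.
  apply/eqP; rewrite eq_le; apply/andP; split; last first.
    exact: packing_premeasure_ge0.
  apply/lee_addgt0Pr => e e0; rewrite add0e.
  have sp0 : 0 < s - p%:R by rewrite subr_gt0.
  pose d := Num.min 1 ((e / C) `^ (s - p%:R)^-1 / 2).
  have eC : 0 < e / C by rewrite divr_gt0.
  have d0 : 0 < d by rewrite lt_min ltr01/= divr_gt0// powR_gt0.
  apply: (@le_trans _ _ (packing_premeasure_delta s d (limit_set T))).
    by apply: ereal_inf_lbound; exists d.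
  apply: ge_ereal_sup => _ [P PP <-]; apply: (le_trans (CP d P _ PP)).
    by rewrite d0 ge_min lexx.
  rewrite lee_fin mulrC -ler_pdivlMr//.
  have -> : e / C = ((e / C) `^ (s - p%:R)^-1) `^ (s - p%:R).
    by rewrite -powRrM mulVf ?gt_eqF// powRr1// ltW.
  apply: ge0_ler_powR; [exact: ltW| | |].
  - by rewrite nnegrE mulr_ge0// ltW.
  - by rewrite nnegrE powR_ge0.
  - by rewrite mulrC -ler_pdivlMr// ge_min lexx orbT.
apply/eqP; rewrite eq_le; apply/andP; split.
  apply: ereal_inf_lbound; exists (fun=> limit_set T).
    by move=> x Ax; exists 0%N.
  by rewrite eseries0.
apply: le_ereal_inf_tmp => _ [F _ <-]; apply: nneseries_ge0 => n _ _.
exact: packing_premeasure_ge0.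
Qed.
End UpperBound.

(** * The packing dimension of a limit set is at least p *)

Section LowerBound.
Variables (R : realType) (p : nat) (T : cantor_scheme R p).

Lemma packing_size_range (V : pseudoMetricType R) (s : R) (I : finType)
    (h : I -> V) (r : R) : injective h -> 0 < r ->
  packing_size s (range (fun i => (h i, r))) = (#|I|%:R * (2 * r) `^ s)%:E.
Proof.
move=> inj r0; rewrite /packing_size esum_image; last by move=> i j _ _ [/inj].
rewrite esum_fset; last 2 first.
- exact: finite_finset.
- by move=> i _; rewrite lee_fin powR_ge0.
rewrite (fsbigE (enum I)) ?enum_uniq//; last by move=> i; rewrite mem_enum.
rewrite big_enum_cond (eq_bigl xpredT) => [|i]; last by rewrite [X in _ && X]mem_set ?andbT.
rewrite /= sumEFin sumr_const (eq_card (B := I))//.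
by rewrite -[in LHS](mulr_natl (_ `^ s)).
Qed.

Lemma closed_ball_row m (x y : 'rV[R]_m) (r : R) i : 0 < r ->
  closed_ball x r y -> `|x ord0 i - y ord0 i| < 2 * r.
Proof.
move=> r0 xy.
have : ball x (2 * r) y.
  apply: subset_closure_half; first by rewrite mulr_gt0.
  by rewrite [2 * r]mulrC mulfK.
by case/ball_row.
Qed.

(** Below s there are nodes of arbitrarily high level, and F meets each of their
    children.  Balls of radius gap centred at these points of F form a packing
    whose size is at least 1 / tol by [kids_many]. *)
Lemma dense_premeasure (s0 : R) (s : node T) (F : set 'rV[R]_p.+1) :
  0 <= s0 < p%:R ->
  (forall t, below s t -> exists2 xi, F xi & xi \isin t) ->
  packing_premeasure s0 F = +oo%E.
Proof.
move=> /andP[s00 s0p] dense; apply/eqyP => M M0.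
apply: le_ereal_inf_tmp => _ [d /= d0 <-].
have [|k0 k0P] := tol_lt R (Num.min d (Num.min (p%:R - s0) M^-1)).
  by rewrite !lt_min d0 subr_gt0 s0p invr_gt0.
have [t st k0t] := below_level R p T s k0.
have := k0P _ k0t; rewrite !lt_min => /and3P[td tp tM].
have tol0 : 0 < tol R (lev T t) by case/andP: (tol_bounds R (lev T t)).
have /choice[xi xiP] : forall j, exists x, F x /\ x \isin kid T t j.
  move=> j; have [|x Fx xj] := dense (kid T t j); last by exists x.
  apply: below_trans st _; apply: below_step (below_refl _ _ _ _).
have g0 : 0 < gap T t by exact: gap_gt0.
have far j k : j != k -> exists i, 4 * gap T t <= `|xi j ord0 i - xi k ord0 i|.
  move=> jk; have [i [_ h]] := kid_sep T t j k jk _ _ (xiP j).2 (xiP k).2.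
  by exists (lift ord0 i).
have xinj : injective xi.
  move=> j k jk; apply/eqP/negP => /negP /far[i]; rewrite jk subrr normr0.
  by apply/negP; rewrite -ltNge mulr_gt0.
apply: (@le_trans _ _ (packing_size s0 (range (fun j => (xi j, gap T t))))).
  rewrite packing_size_range// lee_fin.
  apply: (@le_trans _ _ (tol R (lev T t))^-1).
    by rewrite -[M]invrK lef_pV2 ?posrE ?invr_gt0// ltW.
  apply: (le_trans (kids_many T t)); rewrite ler_wpM2l//.
  apply: ger_powR.
    rewrite mulr_gt0//=; apply: (le_trans (ler_wpM2l _ (gap_le T t))) => //.
    by rewrite -ler_pdivlMl// mulr1 tol_le_half.
  by rewrite lerBrDr -lerBrDl ltW.
apply: ereal_sup_ubound; eexists; last reflexivity.
split=> [_ [j _ <-]/=|]; first split=> //.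
- exact: (xiP j).1.
- by rewrite (le_trans (gap_le _ _))// ltW.
- move=> _ _ [j _ <-] [k _ <-] [z /= [zj zk]].
  have [->//|/far[i hi]] := eqVneq j k; exfalso; move: hi; apply/negP; rewrite -ltNge.
  have := closed_ball_row _ _ _ _ i g0 zj; have := closed_ball_row _ _ _ _ i g0 zk.
  rewrite !ltr_norml => /andP[? ?] /andP[? ?]; apply/andP; split; lra.
Qed.

(** Baire's argument.  If the premeasures of a cover F had a finite sum, no F n
    would meet all nodes below a given one; so one could descend to nodes avoiding
    F 0, F 1, ... in turn, and the limit point would not be covered. *)
Lemma packing_measure_limit_neq0 (s0 : R) : 0 <= s0 < p%:R ->
  packing_measure s0 (limit_set T) <> 0%E.
Proof.
move=> s0p pm0.
have : (packing_measure s0 (limit_set T) < 1%:E)%E by rewrite pm0 lte_fin.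
move=> /ereal_inf_lt[_ [F cover <-] sum1].
have Ffin n : packing_premeasure s0 (F n) <> +oo%E.
  move=> Foo; move: sum1; apply/negP; rewrite -leNgt.
  apply: le_trans (nneseries_lim_ge n.+1 _); last first.
    by move=> k _ _; exact: packing_premeasure_ge0.
  rewrite big_nat_recr//= Foo addey ?leey//.
  rewrite gt_eqF// (@lt_le_trans _ _ 0%E)//.
  by apply: sume_ge0 => k _; exact: packing_premeasure_ge0.
have avoid (n : nat) (s : node T) : exists t,
    (exists j, below (kid T s j) t) /\ forall xi, F n xi -> ~ xi \isin t.
  have [j _] := some_kid R p T s.
  apply: contrapT => H; apply: (Ffin n); apply: (dense_premeasure s0 (kid T s j)) => //.
  move=> t jt; apply: contrapT => H'; apply: H; exists t; split; first by exists j.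
  by move=> xi Fxi xit; apply: H'; exists xi.
have step (x : nat * node T) : {y : nat * node T |
    y.1 = x.1.+1 /\ ((exists j, below (kid T x.2 j) y.2) /\
      forall xi, F x.1 xi -> ~ xi \isin y.2)}.
  by apply: cid; have [t ht] := avoid x.1 x.2; exists (x.1.+1, t).
have [g [g0 gS]] := dependent_choice step (0%N, root T).
have gn n : (g n).1 = n by elim: n => [|n IH]; rewrite ?g0// (gS n).1 IH.
have [||xi xiA xig] := limit_point R p T (fun n => (g n).2).
- by rewrite g0; exact: below_refl.
- by move=> n; exact: (gS n).2.1.
have [n _ Fn] := cover xi xiA.
by apply: (gS n).2.2 (xig n.+1); rewrite gn.
Qed.

Lemma limit_set_nonempty : exists xi, limit_set T xi.
Proof.
have step (x : node T) : {y | exists j, below (kid T x j) y}.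
  apply: cid; have [j _] := some_kid R p T x.
  by exists (kid T x j), j; exact: below_refl.
have [g [g0 gS]] := dependent_choice step (root T).
have [||xi xiA _] := limit_point R p T g; last by exists xi.
- by rewrite g0; exact: below_refl.
- exact: gS.
Qed.

Lemma packing_dimension_limit : (0 < p)%N ->
  packing_dimension (limit_set T) = (p%:R)%:E.
Proof.
move=> p0; apply/eqP; rewrite eq_le; apply/andP; split.
  apply/lee_addgt0Pr => e e0; apply: ereal_inf_lbound.
  exists (p%:R + e) => //; split; first by rewrite addr_ge0// ltW.
  by apply: packing_measure_limit0 => //; rewrite ltrDl.
apply: le_ereal_inf_tmp => _ [s [s0 sP] <-]; rewrite lee_fin leNgt.
by apply/negP => sp; apply: packing_measure_limit_neq0 sP; rewrite s0.
Qed.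
End LowerBound.

(** * Points with a given Dirichlet constant *)

Section Construction.
Variables (R : realType) (p : nat) (c : R).
Hypothesis p0 : (0 < p)%N.
Hypothesis c01 : 0 <= c <= 1.
Local Notation tol := (tol R).

Record state := State {
  st_lev : nat;
  st_ctr : 'rV[R]_p.+1;
  st_den : nat;
  st_rad : R;
  st_den_gt0 : (0 < st_den)%N;
  st_integral : forall i, st_den%:R * st_ctr ord0 i \is a Num.int;
  st_rad_gt0 : 0 < st_rad
}.

Definition st_near s xi := near_pt (st_ctr s) xi (st_rad s).

Definition dirichlet_link (s t : state) : Prop :=
  (st_den s < st_den t)%N /\
  forall xi, st_near t xi ->
    [/\ forall Q, (st_den s)%:R <= Q -> Q <= (st_den t)%:R ->
          Q `^ (p.+1%:R^-1) * psi xi Q <= c + 2 * tol (st_lev s),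
        exists2 Q, (st_den s)%:R <= Q &
          c - tol (st_lev s) <= Q `^ (p.+1%:R^-1) * psi xi Q &
        (st_den s)%:R ^+ st_lev s * psi xi (st_den s)%:R <= tol (st_lev s)].

(** The target of [stage] must be positive, even for c = 0, hence the maximum of c
    and the tolerance. *)
Lemma state_children (s : state) : exists y : {I : finType & ((I -> state) * R)%type},
  let: existT J (kd, r) := y in
  [/\ 0 < r <= tol (st_lev s),
     (tol (st_lev s))^-1 <= #|J|%:R * (2 * r) `^ (p%:R - tol (st_lev s)),
     forall j, [/\ st_lev (kd j) = (st_lev s).+1, st_rad (kd j) <= tol (st_lev s),
       forall xi, st_near (kd j) xi -> st_near s xi & dirichlet_link s (kd j)] &
     forall j k, j != k -> forall xi eta,
       st_near (kd j) xi -> st_near (kd k) eta -> exists i : 'I_p,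
      `|xi ord0 ord0 - eta ord0 ord0| <=
        `|xi ord0 (lift ord0 i) - eta ord0 (lift ord0 i)| /\
      4 * r <= `|xi ord0 (lift ord0 i) - eta ord0 (lift ord0 i)|].
Proof.
set e := tol (st_lev s).
have /andP[e0 e1] : 0 < e < 1 by exact: tol_bounds.
have /andP[c0 c1] := c01.
have c01' : 0 < Num.max c e <= 1 by rewrite lt_max e0 orbT ge_max c1 ltW.
have cle : Num.max c e <= c + e by rewrite ge_max lerDl lerDr c0 ltW.
have cge : c <= Num.max c e by rewrite le_max lexx.
have e01 : 0 < e < 1 by rewrite e0.
have [I [w [q [tau [r [re cnt kP sep num]]]]]] :=
  stage R p _ e _ _ _ (st_lev s) p0 c01' e01 (st_den_gt0 s) (st_integral s) (st_rad_gt0 s).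
have q0 j : (0 < q j)%N by have [h _ _ _] := kP j; exact: leq_ltn_trans h.
have wq j : forall i, (q j)%:R * w j ord0 i \is a Num.int by have [] := kP j.
have tau0 j : 0 < tau j by have [_ _ /andP[]] := kP j.
pose kd j := State (st_lev s).+1 (w j) (q j) (tau j) (q0 j) (wq j) (tau0 j).
exists (existT _ I (kd, r)); split => //.
- move=> j; have [h1 h2 /andP[_ h3] h4] := kP j; split => //.
  split=> // xi xij; have [n1 [Q qQ n2] n3] := num j xi xij; split => //.
    move=> S h5 h6; apply: (le_trans (n1 S h5 h6)); rewrite -/e; lra.
  by exists Q => //; apply: le_trans n2; rewrite -/e; lra.
Qed.

(** Denominators increase along a branch, so the ranges treated by consecutive
    links cover all large Q. *)
Lemma dirichlet_scheme : exists T : cantor_scheme R p, forall xi, limit_set T xi ->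
  dirichlet_constant xi = c%:E /\
  forall N : R,
    limf_einf (fun Q : R => (Q `^ N * psi xi Q)%:E) (pinfty_nbhs R) = 0%E.
Proof.
have [D DP] := choice state_children.
pose I s := projT1 (D s).
pose kd s : I s -> state := (projT2 (D s)).1.
pose r s := (projT2 (D s)).2.
have laws s : [/\ 0 < r s <= tol (st_lev s),
     (tol (st_lev s))^-1 <= #|I s|%:R * (2 * r s) `^ (p%:R - tol (st_lev s)),
     forall j, [/\ st_lev (kd s j) = (st_lev s).+1, st_rad (kd s j) <= tol (st_lev s),
       forall xi, st_near (kd s j) xi -> st_near s xi & dirichlet_link s (kd s j)] &
     forall j k, j != k -> forall xi eta,
       st_near (kd s j) xi -> st_near (kd s k) eta -> exists i : 'I_p,
      `|xi ord0 ord0 - eta ord0 ord0| <=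
        `|xi ord0 (lift ord0 i) - eta ord0 (lift ord0 i)| /\
      4 * r s <= `|xi ord0 (lift ord0 i) - eta ord0 (lift ord0 i)|].
  by have := DP s; rewrite /kd /r /I; case: (D s) => J [k x].
clearbody I kd r.
have root_int (i : 'I_p.+1) : 1%:R * (0 : 'rV[R]_p.+1) ord0 i \is a Num.int.
  by rewrite mxE mulr0; exact: rpred0.
pose rt := State 0 0 1 1 isT root_int ltr01.
have l1 s (j : I s) : st_lev (kd s j) = (st_lev s).+1 by have [_ _ /(_ j)[]] := laws s.
have l2 s (j : I s) : st_rad (kd s j) <= tol (st_lev s) by have [_ _ /(_ j)[]] := laws s.
have l3 s : 0 < r s by have [/andP[]] := laws s.
have l4 s : r s <= tol (st_lev s) by have [/andP[]] := laws s.
have l5 s : (tol (st_lev s))^-1 <= #|I s|%:R * (2 * r s) `^ (p%:R - tol (st_lev s)).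
  by have [] := laws s.
have l6 s (j : I s) xi : st_near (kd s j) xi -> st_near s xi.
  by have [_ _ /(_ j)[_ _ h _] _] := laws s; exact: h.
have l7 s : forall j k : I s, j != k -> forall xi eta,
       st_near (kd s j) xi -> st_near (kd s k) eta -> exists i : 'I_p,
      `|xi ord0 ord0 - eta ord0 ord0| <=
        `|xi ord0 (lift ord0 i) - eta ord0 (lift ord0 i)| /\
      4 * r s <= `|xi ord0 (lift ord0 i) - eta ord0 (lift ord0 i)|.
  by have [_ _ _] := laws s.
pose T := CantorScheme R p state rt I kd st_ctr st_rad r st_lev l1 st_rad_gt0 l2 l3 l4 l5 l6 l7.
exists T => xi [g [g0 gP]].
pose q n := st_den (g n).
have glev n : st_lev (g n) = n.
  elim: n => [|n IH]; first by rewrite g0.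
  by have [[j ->] _] := gP n; rewrite l1 IH.
have link n : dirichlet_link (g n) (g n.+1).
  by have [[j ->] _] := gP n; have [_ _ /(_ j)[]] := laws (g n).
have xin n : st_near (g n) xi by have [] := gP n.
have qS n : (q n < q n.+1)%N by exact: (link n).1.
have qn n : (n < q n)%N by elim: n => [|n IH]; [exact: st_den_gt0|exact: leq_ltn_trans (qS n)].
have qnR n : n%:R <= (q n)%:R :> R by rewrite ler_nat ltnW.
split.
  apply: limf_esup_eq => [e e0|e Q0 e0].
    have [|k0 k0P] := tol_lt R (e / 2); first by rewrite divr_gt0.
    exists (q k0)%:R => Q qQ.
    have ex : exists n, Q < (q n)%:R.
      by exists (Num.truncn Q).+1; apply: (lt_le_trans (truncnS_gt _)).
    case: (ex_minnP ex) => -[|n] Qn nmin.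
      exfalso; move: Qn; apply/negP; rewrite -leNgt; apply: le_trans qQ.
      by rewrite ler_nat; elim: (k0) => // k; move/leq_trans; apply; exact: ltnW.
    have nQ : (q n)%:R <= Q.
      by rewrite leNgt; apply/negP => /nmin; rewrite ltnn.
    have k0n : (k0 <= n)%N.
      have [//|nk] := leqP k0 n; exfalso.
      have : (q n.+1 <= q k0)%N.
        move: nk => /subnK <-; elim: (k0 - n.+1)%N => // k; move/leq_trans; apply.
        exact: ltnW.
      by rewrite -(ler_nat R) => h; have := lt_le_trans Qn (le_trans h qQ); rewrite ltxx.
    have [h _ _] := (link n).2 xi (xin n.+1).
    apply: (le_trans (h Q nQ (ltW Qn))); rewrite lerD2l glev.
    by rewrite mulrC -ler_pdivlMr// ltW// k0P.
  have [k0 k0P] := tol_lt R e e0.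
  pose n := maxn k0 (Num.truncn Q0).+1.
  have [_ [Q qQ h] _] := (link n).2 xi (xin n.+1).
  exists Q.
    apply: le_trans qQ; apply: le_trans (qnR n); apply/ltW/(lt_le_trans (truncnS_gt _)).
    by rewrite ler_nat leq_maxr.
  apply: le_trans h; rewrite lerD2l lerN2 glev ltW// k0P//.
  exact: leq_maxl.
move=> N; apply: limf_einf_eq0 => [Q|e Q0 e0]; first by rewrite mulr_ge0// ?powR_ge0// psi_ge0.
have [k0 k0P] := tol_lt R e e0.
pose n := maxn k0 (maxn (Num.truncn Q0).+1 (Num.truncn N).+1).
have [_ _ h] := (link n).2 xi (xin n.+1); rewrite glev in h.
exists (q n)%:R.
  apply: le_trans (qnR n); apply/ltW/(lt_le_trans (truncnS_gt _)).
  by rewrite ler_nat /n maxnCA leq_maxl.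
apply: (@le_trans _ _ (tol n)); last by rewrite ltW// k0P// leq_maxl.
apply: le_trans h; rewrite ler_wpM2r ?psi_ge0// -powR_mulrn//.
apply: ler_powR; first by rewrite ler1n (leq_ltn_trans _ (qn n)).
apply/ltW/(lt_le_trans (truncnS_gt _)).
by rewrite ler_nat /n maxnC -maxnA maxnCA leq_maxl.
Qed.
End Construction.

(** For the upper bound, Dirichlet's theorem with N the integer part of the m-th
    root of Q gives Q^(1/m) psi(Q) <= (N + 1) / N. *)
Lemma dirichlet_constant_bounds (R : realType) (m : nat) (xi : 'rV[R]_m) :
  (0 < m)%N -> (0 <= dirichlet_constant xi <= 1)%E.
Proof.
move=> m0; apply/andP; split.
  apply: limf_esup_ge0 => [|Q]; last by rewrite lee_fin mulr_ge0 ?powR_ge0 ?psi_ge0.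
  by move=> [M [_ /(_ (M + 1))]]; apply; rewrite ltrDl.
apply/lee_addgt0Pr => e e0.
pose N0 := (Num.truncn e^-1).+1.
pose Q0 : R := N0%:R ^+ m.
apply: (@le_trans _ _ (ereal_sup ((fun Q : R => (Q `^ m%:R^-1 * psi xi Q)%:E)
    @` [set Q | Q0 < Q]))).
  apply: ereal_inf_lbound; exists [set Q | Q0 < Q] => //.
  by exists Q0; split => //; exact: num_real.
apply: ge_ereal_sup => _ [Q /= QQ <-]; rewrite -EFinD lee_fin.
have Q00 : 0 <= Q0 by rewrite exprn_ge0.
have Qge0 : 0 <= Q by rewrite (le_trans Q00)// ltW.
have [N /andP[NQ QN]] := @nat_root R m Q m0 Qge0.
have N0N : (N0 <= N)%N.
  rewrite -ltnS -(ltr_nat R); have := lt_trans QQ QN.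
  by rewrite ltr_pXn2r ?nnegrE.
have N_gt0 : (0 < N)%N by exact: leq_trans N0N.
have NR : 0 < N%:R :> R by rewrite ltr0n.
have [k [/andP[k0 kN] kP]] := dirichlet _ _ N (fun i => xi ord0 i) N_gt0.
have ps : psi xi Q <= N%:R^-1.
  apply: (@psi_le _ _ xi k) => //.
  by apply: le_trans NQ; rewrite -natrX ler_nat.
apply: (@le_trans _ _ (N.+1%:R * N%:R^-1)).
  apply: ler_pM => //; [exact: powR_ge0|exact: psi_ge0|].
  rewrite -(@ler_pXn2r _ m)// ?nnegrE ?powR_ge0// mroot_expK//.
  exact: ltW.
rewrite -natr1 mulrDl divff ?gt_eqF// mul1r lerD2l.
rewrite -[e]invrK lef_pV2 ?posrE ?invr_gt0//.
by apply/ltW/(lt_le_trans (truncnS_gt _)); rewrite ler_nat.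
Qed.

Theorem theorem2p1 (R : realType) (m : nat) (hm : (2 <= m)%N) :
  (forall c : R, 0 <= c <= 1 ->
    exists A : set 'rV[R]_m,
      packing_dimension A = (m%:R - 1)%:E /\
      forall xi : 'rV[R]_m, A xi ->
        dirichlet_constant xi = c%:E /\
        forall N : R,
          limf_einf (fun Q : R => (Q `^ N * psi xi Q)%:E) (pinfty_nbhs R) = 0%E) /\
  dirichlet_spectrum m = [set c%:E | c in [set c : R | 0 <= c <= 1]].
Proof.
case: m hm => [//|p] hp; have p0 : (0 < p)%N by [].
have m1 : p.+1%:R - 1 = p%:R :> R by rewrite -natr1 addrK.
split.
  move=> c c01; have [T TP] := dirichlet_scheme R p c p0 c01.
  exists (limit_set T); split; last exact: TP.
  by rewrite m1 packing_dimension_limit.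
apply/seteqP; split=> [_ [xi _ <-]|_ [c c01 <-]].
  have := dirichlet_constant_bounds R p.+1 xi isT.
  case: (dirichlet_constant xi) => [c c01| |]; first by exists c.
    by rewrite leye_eq andbF.
  by rewrite leeNy_eq.
have [T TP] := dirichlet_scheme R p c p0 c01.
have [xi xiA] := limit_set_nonempty R p T.
by exists xi => //; have [] := TP xi xiA.
Qed.
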